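(* Let $f\in\mathbb{C}[x_0,\dots,x_n]_3$. If $\dim\mathrm{Reg}(f)\le 0$, then $f$ has at most $2^{n+1}-1$ regular eigenpoints. Moreover: (1) for every $t\in\{0,1,\dots,7\}$ there exists a ternary cubic $f\in\mathbb{C}[x_0,x_1,x_2]_3$ such that $\mathrm{Reg}(f)$ is reduced and consists of $t$ real points; (2) for every $t\in\{0,1,\dots,15\}$ there exists a quaternary cubic $f\in\mathbb{C}[x_0,x_1,x_2,x_3]_3$ such that $\mathrm{Reg}(f)$ is reduced and consists of $t$ real points.
   Context: For $f\in\mathbb{C}[x_0,\dots,x_n]_3$ put $q_i=\frac{\partial f}{\partial x_i}$. The eigenscheme $E(f)\subset\mathbb{P}^n$ is the closed subscheme defined by the $2\times2$ minors of the matrix with rows $(x_0,\dots,x_n)$ and $(q_0,\dots,q_n)$. The irregular eigenscheme $\mathrm{Irr}(f)\subset\mathbb{P}^n$ is the closed subscheme defined by the ideal $(q_0,\dots,q_n)$. The regular eigenscheme $\mathrm{Reg}(f)$ is the residue of $E(f)$ with respect to $\mathrm{Irr}(f)$, i.e. the closed subscheme of $\mathbb{P}^n$ defined by the saturation $\left(I(E(f)):I(\mathrm{Irr}(f))^{\infty}\right)$. The regular eigenpoints of $f$ are the points $p\in\mathbb{P}^n$ such that the rational map $[q_0,\dots,q_n]:\mathbb{P}^n\dashrightarrow\mathbb{P}^n$ is regular at $p$ (not all $q_i$ vanish at $p$) and fixes $p$. The empty scheme has dimension $-1$. A point of $\mathbb{P}^n$ is real if it has a representative with real homogeneous coordinates.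 *)

(* Defs.v *)
(* Cubic forms over C := R[i], for R an arbitrary model of the reals, and the
   projective schemes Proj (C[x_0, ..., x_n] / I) attached to them. *)
From HB Require Import structures.
From mathcomp Require Import all_boot all_order all_algebra.
From mathcomp Require Import boolp classical_sets cardinality reals.
From mathcomp Require Import complex mpoly.

Set Implicit Arguments.
Unset Strict Implicit.
Unset Printing Implicit Defensive.

Import Order.TTheory GRing.Theory Num.Theory.
Local Open Scope classical_set_scope.
Local Open Scope ring_scope.

(* P^n as the set of lines of C^(n+1). *)
Definition ppoint (R : realType) (n : nat) : Type :=
  {U : {vspace 'rV[R[i]]_n.+1} | \dim U == 1%N}.

Definition real_point (R : realType) (n : nat) (p : ppoint R n) : Prop :=
  exists2 v : 'rV[R[i]]_n.+1,
    val p = <[v]>%VS & forall i, v 0 i \is Num.real.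

Definition grad_at (R : realType) (n : nat) (f : {mpoly R[i][n.+1]})
    (v : 'rV[R[i]]_n.+1) : 'rV[R[i]]_n.+1 :=
  \row_i (f^`M(i)).@[fun j => v 0 j].

Definition regular_eigenpoint (R : realType) (n : nat)
    (f : {mpoly R[i][n.+1]}) (p : ppoint R n) : Prop :=
  exists v : 'rV[R[i]]_n.+1,
    [/\ val p = <[v]>%VS, grad_at f v != 0 & <[grad_at f v]>%VS = val p].

Definition ideal_gen (A : comNzRingType) (T : finType) (g : T -> A) : set A :=
  [set p | exists h : T -> A, p = \sum_i h i * g i].

(* (I : J^oo). As I is an ideal and J^k is spanned by the k-fold products of
   elements of J, it is enough to test p * J^k \subset I on these products. *)
Definition saturation (A : comNzRingType) (I J : set A) : set A :=
  [set p | exists k : nat, forall s : 'I_k -> A,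
     (forall i, J (s i)) -> I (p * \prod_i s i)].

Definition eigen_ideal (R : realType) (n : nat) (f : {mpoly R[i][n.+1]}) :
    set {mpoly R[i][n.+1]} :=
  ideal_gen (fun ij : 'I_n.+1 * 'I_n.+1 =>
    'X_(ij.1) * f^`M(ij.2) - 'X_(ij.2) * f^`M(ij.1)).

Definition irr_ideal (R : realType) (n : nat) (f : {mpoly R[i][n.+1]}) :
    set {mpoly R[i][n.+1]} :=
  ideal_gen (fun i : 'I_n.+1 => f^`M(i)).

Definition reg_ideal (R : realType) (n : nat) (f : {mpoly R[i][n.+1]}) :
    set {mpoly R[i][n.+1]} :=
  saturation (eigen_ideal f) (irr_ideal f).

Definition homog_ideal (R : realType) (n : nat)
    (P : set {mpoly R[i][n.+1]}) : Prop :=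
  forall p d, P p -> P (pihomog mdeg d p).

(* The points of the scheme Proj (C[x_0, ..., x_n] / I). *)
Definition proj_pt (R : realType) (n : nat) (I P : set {mpoly R[i][n.+1]}) :
    Prop :=
  [/\ idealr_closed (mem P), prime_idealr_closed (mem P), homog_ideal P,
      I `<=` P & exists i : 'I_n.+1, ~ P 'X_i].

(* Irreducible closed subsets of Proj correspond to its points, with reversed
   inclusion, so this is a chain of k + 1 irreducible closed subsets. *)
Definition proj_chain (R : realType) (n : nat) (I : set {mpoly R[i][n.+1]})
    (k : nat) : Prop :=
  exists c : nat -> set {mpoly R[i][n.+1]},
    (forall i, (i <= k)%N -> proj_pt I (c i)) /\
    (forall i, (i < k)%N -> c i `<` c i.+1).

(* dim Proj (C[x_0, ..., x_n] / I) <= d, where the dimension is the supremum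
   of the lengths of chains, and is -1 if there is no chain at all. *)
Definition proj_dim_le (R : realType) (n : nat) (I : set {mpoly R[i][n.+1]})
    (d : int) : Prop :=
  -1 <= d /\ forall k : nat, proj_chain I k -> k%:Z <= d.

(* a / s = 0 in the localization of C[x_0, ..., x_n] / I at the homogeneous
   elements outside P; the denominator s is irrelevant. *)
Definition stalk_zero (R : realType) (n : nat) (I P : set {mpoly R[i][n.+1]})
    (a : {mpoly R[i][n.+1]}) : Prop :=
  exists e (u : {mpoly R[i][n.+1]}), [/\ u \is e.-homog, ~ P u & I (u * a)].

(* All the local rings are reduced. The local ring of Proj at P consists of
   the fractions a / s with a, s homogeneous of the same degree, s not in P. *)
Definition proj_reduced (R : realType) (n : nat)
    (I : set {mpoly R[i][n.+1]}) : Prop :=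
  forall (P : set {mpoly R[i][n.+1]}) (d : nat) (a s : {mpoly R[i][n.+1]}),
    proj_pt I P -> a \is d.-homog -> s \is d.-homog -> ~ P s ->
    forall k : nat, stalk_zero I P (a ^+ k) -> stalk_zero I P a.

Definition point_ideal (R : realType) (n : nat) (p : ppoint R n) :
    set {mpoly R[i][n.+1]} :=
  [set g | forall v : 'rV[R[i]]_n.+1, v \in val p -> g.@[fun i => v 0 i] = 0].

(* The underlying set of Proj (C[x_0, ..., x_n] / I) is made of t closed
   points, all of them real. *)
Definition consists_of_real_points (R : realType) (n : nat)
    (I : set {mpoly R[i][n.+1]}) (t : nat) : Prop :=
  exists A : set (ppoint R n),
    [/\ (A #= `I_t)%card, forall p, A p -> real_point p &
        [set P | proj_pt I P] = [set point_ideal p | p in A]].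

(* Main.v *)
(* The regular eigenpoints of f are the lines spanned by the nonzero solutions of
   the affine system q(v) = v, where q is the gradient of f; let I be the ideal
   generated by the q_i - x_i.

   Bound.  If Reg(f) has dimension at most 0, then C[x]/I is finite-dimensional:
   otherwise a prime P containing I makes some x_j transcendental, the homogeneous
   part P^h of P is a point of Reg(f), and since no homogeneous prime lies
   strictly between P^h and the irrelevant ideal, the forms q_j and x_j^2 are
   algebraically dependent modulo P^h; as q_j = x_j modulo P, this is a
   polynomial equation for x_j modulo P.  Then, I being generated by quadrics,
   polynomials of degree at most 2d + c represent everything modulo I^d.  They
   surject onto the d-jets at the solutions, so that
   #solutions * binom(d - 1 + N, N) <= binom(2d + c + N, N) with N = n + 1, and
   d -> oo gives #solutions <= 2^N.  The origin is one of the solutions.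

   Examples.  Modulo the 2x2 minors x = (x_j / q_j) q wherever q_j is invertible,
   so homogeneous elements of I lie in the ideal of Reg(f).  If each coordinate
   satisfies a squarefree split equation modulo I, then I is radical (Seidenberg)
   and Reg(f) is reduced and consists of the nonzero solutions.  The number of
   solutions is multiplicative under direct sums of cubics, which leaves the
   counts 1, 2, 3, 5, 7, 11, 13, 15 to be realized by explicit cubics. *)
Require Import Defs.
From HB Require Import structures.
From mathcomp Require Import all_boot all_order all_algebra.
From mathcomp Require Import boolp classical_sets cardinality reals.
From mathcomp Require Import complex mpoly.
From mathcomp Require Import finmap.
From mathcomp Require Import ring zify.
Import Order.TTheory GRing.Theory Num.Theory.

Set Implicit Arguments.
Unset Strict Implicit.
Unset Printing Implicit Defensive.

Local Open Scope classical_set_scope.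
Local Open Scope ring_scope.

(** * Ideals and primes *)

Definition is_ideal (A : comNzRingType) (I : set A) : Prop :=
  [/\ I 0, forall a b, I a -> I b -> I (a + b) & forall a b, I b -> I (a * b)].

Definition is_prime (A : comNzRingType) (P : set A) : Prop :=
  [/\ is_ideal P, ~ P 1 & forall a b, P (a * b) -> P a \/ P b].

Definition ideal_plus (A : comNzRingType) (I : set A) (a : A) : set A :=
  [set x | exists y, I (x - y * a)].

Section Ideals.
Context {A : comNzRingType}.
Implicit Types (I J P : set A) (a b x y : A).

Lemma idealD I a b : is_ideal I -> I a -> I b -> I (a + b).
Proof. by case=> _ + _; apply. Qed.

Lemma idealMl I a b : is_ideal I -> I b -> I (a * b).
Proof. by case=> _ _; apply. Qed.

Lemma idealMr I a b : is_ideal I -> I a -> I (a * b).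
Proof. by move=> idI Ia; rewrite mulrC; apply: idealMl. Qed.

Lemma idealN I a : is_ideal I -> I a -> I (- a).
Proof. by move=> idI Ia; rewrite -mulN1r; apply: idealMl. Qed.

Lemma idealB I a b : is_ideal I -> I a -> I b -> I (a - b).
Proof. by move=> idI Ia Ib; apply: idealD => //; apply: idealN. Qed.

Lemma ideal_sum I (T : Type) (r : seq T) (p : pred T) (F : T -> A) :
  is_ideal I -> (forall i, p i -> I (F i)) -> I (\sum_(i <- r | p i) F i).
Proof.
move=> idI IF; apply: (big_ind I) => //; first by case: idI.
by move=> ? ?; apply: idealD.
Qed.

Lemma ideal_sum_seq I (T : eqType) (r : seq T) (F : T -> A) :
  is_ideal I -> (forall i, i \in r -> I (F i)) -> I (\sum_(i <- r) F i).
Proof. by move=> idI IF; rewrite big_seq; apply: ideal_sum. Qed.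

Lemma ideal_congr I a b : is_ideal I -> I (a - b) -> I b -> I a.
Proof. by move=> idI Iab Ib; rewrite -(subrK b a); apply: idealD. Qed.

Lemma ideal_trans I a b c : is_ideal I -> I (a - b) -> I (b - c) -> I (a - c).
Proof. by move=> idI ab bc; rewrite -(subrK b a) -addrA; apply: idealD. Qed.

Lemma ideal_sym I a b : is_ideal I -> I (a - b) -> I (b - a).
Proof. by move=> idI ab; rewrite -opprB; apply: idealN. Qed.

Lemma ideal_congrM I a b c d :
  is_ideal I -> I (a - b) -> I (c - d) -> I (a * c - b * d).
Proof.
move=> idI ab cd; rewrite (_ : _ - _ = (a - b) * c + b * (c - d)); last by ring.
by apply: idealD => //; [apply: idealMr | apply: idealMl].
Qed.

Lemma ideal_congrX I a b k : is_ideal I -> I (a - b) -> I (a ^+ k - b ^+ k).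
Proof.
move=> idI ab; elim: k => [|k IHk]; first by rewrite !expr0 subrr; case: idI.
by rewrite !exprS; apply: ideal_congrM.
Qed.

Lemma ideal_plusP I a :
  is_ideal I -> [/\ is_ideal (ideal_plus I a), I `<=` ideal_plus I a
                  & ideal_plus I a a].
Proof.
move=> idI; split; first split.
- by exists 0; rewrite mul0r subr0; case: idI.
- move=> x y [u Iu] [v Iv]; exists (u + v).
  rewrite (_ : _ - _ = (x - u * a) + (y - v * a)); last by ring.
  exact: idealD.
- move=> x y [u Iu]; exists (x * u).
  by rewrite -mulrA -mulrBr; apply: idealMl.
- by move=> x Ix; exists 0; rewrite mul0r subr0.
by exists 1; rewrite mul1r subrr; case: idI.
Qed.

Lemma ideal_gen_ideal (T : finType) (g : T -> A) : is_ideal (ideal_gen g).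
Proof.
split.
- by exists (fun=> 0); rewrite big1 // => i _; rewrite mul0r.
- move=> a b [h ->] [k ->]; exists (fun i => h i + k i).
  by rewrite -big_split /=; apply: eq_bigr => i _; rewrite mulrDl.
- move=> a b [h ->]; exists (fun i => a * h i).
  by rewrite mulr_sumr; apply: eq_bigr => i _; rewrite mulrA.
Qed.

Lemma ideal_gen_mem (T : finType) (g : T -> A) i : ideal_gen g (g i).
Proof.
exists (fun j => (j == i)%:R); rewrite (bigD1 i) //= eqxx mul1r big1 ?addr0 //.
by move=> j /negPf ->; rewrite mul0r.
Qed.

Lemma ideal_gen_sub (T : finType) (g : T -> A) I :
  is_ideal I -> (forall i, I (g i)) -> ideal_gen g `<=` I.
Proof.
by move=> idI Ig _ [h ->]; apply: ideal_sum => // i _; apply: idealMl.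
Qed.

Lemma prime_exp P a k : is_prime P -> P (a ^+ k) -> P a.
Proof.
case=> idP P1 prP; elim: k => [|k IHk]; first by rewrite expr0.
by rewrite exprS => /prP[].
Qed.

(** An ideal maximal among those containing [I] and missing the multiplicative set [S] is prime:
    adjoining an outside element makes it meet [S], and if the product of two outside elements were
    inside, so would be a product of two elements of [S]. *)
Lemma prime_avoiding I (S : set A) :
  is_ideal I -> S 1 -> (forall a b, S a -> S b -> S (a * b)) ->
  (forall a, S a -> ~ I a) ->
  exists P, [/\ is_prime P, I `<=` P & forall a, S a -> ~ P a].
Proof.
move=> idI S1 SM SI.
pose good X := [/\ is_ideal X, I `<=` X & forall a, S a -> ~ X a].
have [|M [Mgood Mmax]] := @Zorn_bigcup A (fun X => X = set0 \/ good X).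
  move=> F Fgood Ftot.
  have [[X0 FX0 X0n0]|Fn] := pselect (exists2 X, F X & X <> set0); last first.
    left; apply: bigcup0 => X FX; apply: contrapT => Xn0.
    by apply: Fn; exists X.
  have gX X x : F X -> X x -> good X.
    by move=> FX Xx; case: (Fgood _ FX) => // XE; rewrite XE in Xx.
  have [idX0 IX0 _] : good X0.
    have [/set0P[x X0x]|/negP/negPn/eqP//] := pselect (is_true (X0 != set0)).
    exact: gX X0x.
  right; split; first split.
  - by exists X0 => //; case: idX0.
  - move=> a b [X FX Xa] [Y FY Yb]; have [XY|YX] := Ftot _ _ FX FY.
      exists Y => //; have [idY _ _] := gX _ _ FY Yb.
      by apply: idealD => //; apply: XY.
    exists X => //; have [idX _ _] := gX _ _ FX Xa.
    by apply: idealD => //; apply: YX.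
  - move=> a b [X FX Xb]; exists X => //.
    by have [idX _ _] := gX _ _ FX Xb; apply: idealMl.
  - by move=> a Ia; exists X0 => //; apply: IX0.
  - by move=> a Sa [X FX Xa]; have [_ _ /(_ a Sa)] := gX _ _ FX Xa.
have {Mgood}[idM IM SM'] : good M.
  case: Mgood => // M0; exfalso; apply: (Mmax I); last first.
    by right; split => //.
  rewrite M0; split; first by [].
  by move=> /(_ 0) H; apply: H; case: idI.
exists M; split=> //; split=> //; first exact: SM'.
move=> a b Mab; apply: contrapT => /not_orP[nMa nMb].
have step x : ~ M x -> exists2 s, S s & ideal_plus M x s.
  move=> nMx; apply: contrapT => noS.
  have [idMx subMx Mxx] := ideal_plusP x idM.
  apply: (Mmax (ideal_plus M x)); first by split=> // /(_ x Mxx).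
  right; split=> //; first exact: subset_trans subMx.
  by move=> s Ss Mxs; apply: noS; exists s.
have [s Ss [u Mu]] := step _ nMa; have [t St [v Mv]] := step _ nMb.
apply: (SM' (s * t)); first exact: SM.
rewrite (_ : s * t = (s - u * a) * t + (u * a) * (t - v * b) + u * v * (a * b));
  last by ring.
by do 2?apply: idealD => //; [apply: idealMr | apply: idealMl | apply: idealMl].
Qed.

End Ideals.

(** * The homogeneous part of an ideal *)

Local Notation hc := (pihomog mdeg).

(** For an ideal [P], the largest homogeneous ideal inside [P], written P^h in the overview. *)
Definition hcore (F : fieldType) (N : nat) (P : set {mpoly F[N]}) : set {mpoly F[N]} :=
  [set a | forall d, P (hc d a)].

Section Homogeneous.
Context {F : fieldType} {N : nat}.
Local Notation A := {mpoly F[N]}.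
Implicit Types (a b u : A) (I P : set A).

Lemma hc_homogM e d u b : u \is e.-homog ->
  hc d (u * b) = if (e <= d)%N then u * hc (d - e)%N b else 0.
Proof.
move=> hu; pose k := maxn (msize b) d.+1.
rewrite [in LHS](@pihomog_partitionE _ _ mdeg k b) ?leq_maxl //.
rewrite mulr_sumr linear_sum /=.
under eq_bigr => i _.
  have hi : u * hc i b \is (e + i).-homog by apply: dhomogM => //; apply: pihomogP.
  have -> : hc d (u * hc i b) = if (e + i)%N == d then u * hc i b else 0.
    case: eqVneq => [<-|ne]; first exact: pihomog_dE.
    exact: pihomog_ne0 hi.
  over.
case: leqP => [led|ltd]; last first.
  by rewrite big1 // => i _; case: eqVneq => // E; move: ltd; rewrite -E ltnNge leq_addr.
have kd : (d - e < k)%N by rewrite /k leq_max orbC ltnS leq_subr.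
rewrite (bigD1 (Ordinal kd)) //= subnKC // eqxx big1 ?addr0 // => i.
rewrite -val_eqE /= => ne; case: eqVneq => // E; case/eqP: ne.
by rewrite -E addKn.
Qed.

Lemma hcM d a b : hc d (a * b) = \sum_(i < d.+1) hc i a * hc (d - i)%N b.
Proof.
pose k := maxn (msize a) d.+1.
rewrite [in LHS](@pihomog_partitionE _ _ mdeg k a) ?leq_maxl //.
rewrite mulr_suml linear_sum /=.
under eq_bigr => i _ do rewrite (hc_homogM d b (pihomogP mdeg i a)).
rewrite (big_ord_widen k (fun i => hc i a * hc (d - i)%N b)) ?leq_maxr //.
by rewrite [RHS]big_mkcond /=.
Qed.

Lemma homog_split a : exists k, a = \sum_(i < k) hc i a.
Proof. by exists (msize a); apply: pihomog_partitionE. Qed.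

Lemma homog_ideal_elt P : is_ideal P -> (hcore P `<=` P).
Proof.
by move=> idP a hPa; have [k ->] := homog_split a; apply: ideal_sum.
Qed.

Lemma hcore_homog P a d : is_ideal P -> a \is d.-homog -> P a -> hcore P a.
Proof.
move=> idP ha Pa e; have [<-|ne] := eqVneq d e; first by rewrite pihomog_dE.
by rewrite (pihomog_ne0 ne ha); case: idP.
Qed.

Lemma hcore_hc P a d : is_ideal P -> hcore P a -> hcore P (hc d a).
Proof. by move=> idP Pa; apply: hcore_homog (pihomogP _ _ _) (Pa d). Qed.

Lemma hcore_ideal P : is_ideal P -> is_ideal (hcore P).
Proof.
move=> idP; split.
- by move=> d; rewrite linear0; case: idP.
- by move=> a b Pa Pb d; rewrite linearD; apply: idealD (Pa d) (Pb d).
- move=> a b Pb d; rewrite hcM; apply: ideal_sum => // i _.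
  exact: idealMl (Pb _).
Qed.

Lemma hcore_sub I P : is_ideal I -> (forall a d, I a -> I (hc d a)) ->
  I `<=` P -> I `<=` hcore P.
Proof. by move=> idI hI IP a Ia d; apply: IP; apply: hI. Qed.


Lemma hcore_top P a : P 0 -> ~ hcore P a ->
  exists d, ~ P (hc d a) /\ forall e, (d < e)%N -> P (hc e a).
Proof.
move=> P0 nPa.
have [i0 i0P] : exists i, `[< ~ P (hc i a) >].
  apply: contrapT => nP; apply: nPa => d; apply: contrapT => nPd.
  by apply: nP; exists d; apply/asboolP.
have bound i : `[< ~ P (hc i a) >] -> (i <= msize a)%N.
  move/asboolP => nPi; rewrite leqNgt; apply/negP => lti; apply: nPi.
  rewrite pihomogE big_seq_cond big_pred0 // => m; apply/negP => /andP[ma /eqP E].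
  by have := msize_mdeg_lt ma; rewrite E ltnNge ltnW.
have ex : exists i, `[< ~ P (hc i a) >] by exists i0.
case: (ex_maxnP ex bound) => d /asboolP nPd dmax.
exists d; split=> // e lte; apply: contrapT => nPe.
have := dmax e; rewrite leqNgt lte /= => H.
by have /H : `[< ~ P (hc e a) >] by apply/asboolP.
Qed.

(** Take the highest components of [a] and [b] outside [P], of degrees [i] and [j]. In degree
    [i + j] every other term of the product has a factor in [P], so primality applies to these two
    components. *)
Lemma hcore_prime P : is_prime P -> is_prime (hcore P).
Proof.
move=> [idP P1 prP]; split; first exact: hcore_ideal.
  by move=> /(homog_ideal_elt idP).
move=> a b hab; apply: contrapT => /not_orP[na nb].
have P0 : P 0 by case: idP.
have [i [nPi maxi]] := hcore_top P0 na; have [j [nPj maxj]] := hcore_top P0 nb.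
have ltij : (i < (i + j).+1)%N by rewrite ltnS leq_addr.
have := hab (i + j)%N; rewrite hcM (bigD1 (Ordinal ltij)) //= addKn => Psum.
have : P (hc i a * hc j b).
  rewrite -(addrK (\sum_(k < (i + j).+1 | k != Ordinal ltij)
    hc k a * hc (i + j - k)%N b) (hc i a * hc j b)).
  apply: idealB => //; apply: ideal_sum => // k.
  rewrite -val_eqE /= neq_ltn => /orP[ltk|gtk].
    by apply: idealMl => //; apply: maxj; lia.
  by apply: idealMr => //; apply: maxi.
by move/prP => [].
Qed.

End Homogeneous.

(** * Finite codimension *)

(** [msize] is the degree plus one on nonzero polynomials, so representatives have degree below [c].
    The counting of jets needs this explicit bound. *)
Definition fincodim (F : fieldType) (N : nat) (I : set {mpoly F[N]}) (c : nat) : Prop :=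
  forall a, exists2 b, (msize b <= c)%N & I (a - b).

Section FiniteCodimension.
Context {F : fieldType} {N : nat}.
Local Notation A := {mpoly F[N]}.
Implicit Types (a b h : A) (I : set A).

Lemma msize_leP k a :
  reflect (forall m, m \in msupp a -> (mdeg m < k)%N) (msize a <= k)%N.
Proof.
apply: (iffP idP) => [le m ma|H].
  exact: leq_trans (msize_mdeg_lt ma) le.
by rewrite msizeE; apply/bigmax_leqP_seq => m ma _; apply: H.
Qed.

Lemma msize_leD k a b : (msize a <= k)%N -> (msize b <= k)%N -> (msize (a + b) <= k)%N.
Proof. by move=> ha hb; apply: leq_trans (msizeD_le _ _) _; rewrite geq_max ha. Qed.

Lemma msize_leM k l a b :
  (msize a <= k.+1)%N -> (msize b <= l)%N -> (msize (a * b) <= k + l)%N.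
Proof.
move=> /msize_leP ha /msize_leP hb; apply/msize_leP => m /msuppM_le.
case/allpairsP => -[m1 m2] /= [/ha h1 /hb h2 ->]; rewrite mdegD; lia.
Qed.

Lemma msize_le_sum k (T : eqType) (r : seq T) (f : T -> A) :
  (forall i, i \in r -> (msize (f i) <= k)%N) -> (msize (\sum_(i <- r) f i)%R <= k)%N.
Proof.
move=> H; rewrite big_seq; apply: (big_ind (fun a => (msize a <= k)%N)) => //.
  by rewrite msize0.
by move=> a b; apply: msize_leD.
Qed.

Lemma homog_msize_le d a : a \is d.-homog -> (msize a <= d.+1)%N.
Proof. by move/dhomogP => ha; apply/msize_leP => m /ha /= ->. Qed.

Lemma horner_algE a (p : {poly F}) : horner_alg a p = \sum_(i < size p) p`_i *: a ^+ i.
Proof.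
rewrite -{1}(coefK p) poly_def linear_sum /=; apply: eq_bigr => i _.
by rewrite linearZ /= rmorphXn /= horner_algX -scalerAl mul1r.
Qed.

Lemma leading_of_algebraic I i (p : {poly F}) : is_ideal I -> p != 0 ->
  I (horner_alg 'X_i p) -> exists k h, (msize h <= k)%N /\ I ('X_i ^+ k - h).
Proof.
move=> idI p0 Ip; exists (size p).-1.
exists (- (lead_coef p)^-1 *: \sum_(l < (size p).-1) p`_l *: 'X_i ^+ l).
split.
  apply: leq_trans (msizeZ_le _ _) _; apply: msize_le_sum => l _.
  apply: leq_trans (msizeZ_le _ _) _.
  by rewrite mpolyXn msizeX mdegMn mdeg1 mul1n.
rewrite scaleNr opprK; set s := \sum_(l < _) _.
have E : horner_alg 'X_i p = lead_coef p *: 'X_i ^+ (size p).-1 + s.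
  have sp : size p = (size p).-1.+1 by rewrite prednK // size_poly_gt0.
  rewrite horner_algE lead_coefE /s; case: (size p) sp => // sz _.
  by rewrite big_ord_recr addrC.
have -> : 'X_i ^+ (size p).-1 + (lead_coef p)^-1 *: s
        = (lead_coef p)^-1 *: horner_alg 'X_i p.
  by rewrite E scalerDr scalerA mulVf ?lead_coef_eq0 // scale1r.
by rewrite -mul_mpolyC; apply: idealMl.
Qed.

(** A monomial of degree at least [c] is divisible by some ['X_i ^+ k i]; trading this factor for
    [h i] lowers the degree. *)
Lemma fincodim_of_leading I : is_ideal I ->
  (forall i, exists k h, (msize h <= k)%N /\ I ('X_i ^+ k - h)) ->
  exists c, fincodim I c.
Proof.
move=> idI /choice[k /choice[h kh]].
exists (\sum_i k i).+1; set c := (_.+1).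
pose good a := exists2 b, (msize b <= c)%N & I (a - b).
have I0 : I 0 by case: idI.
have good_sum (T : eqType) (r : seq T) (f : T -> A) :
    (forall i, i \in r -> good (f i)) -> good (\sum_(i <- r) f i).
  move=> gf; rewrite big_seq; apply: (big_ind good) => //.
    by exists 0; rewrite ?subr0 ?msize0.
  move=> a b [u hu Iu] [v hv Iv]; exists (u + v); first exact: msize_leD.
  by rewrite opprD addrACA; apply: idealD.
have goodZ x a : good a -> good (x *: a).
  move=> [u hu Iu]; exists (x *: u); first exact: leq_trans (msizeZ_le _ _) _.
  by rewrite -scalerBr -mul_mpolyC; apply: idealMl.
suff gooddeg d a : (msize a <= d)%N -> good a by move=> a; apply: (gooddeg (msize a)).
elim: d a => [|d IHd] a.
  rewrite leqn0 msize_poly_eq0 => /eqP ->.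
  by exists 0; rewrite ?subr0 ?msize0.
move=> /msize_leP ha; rewrite (mpolyE a); apply: good_sum => m ma; apply: goodZ.
have [lt|ge] := ltnP (mdeg m) c.
  by exists 'X_[m]; rewrite ?subrr ?msizeX.
have [i kmi] : exists i, (k i <= m i)%N.
  apply/existsP; apply: contraLR ge => /existsPn kn.
  rewrite -ltnNge ltnS mdegE; apply: leq_sum => i _.
  by apply: ltnW; rewrite ltnNge; apply: kn.
have {kh}[hk Ik] := kh i.
have mE : m = ((m - U_(i) *+ k i) + U_(i) *+ k i)%MM.
  rewrite submK //; apply/mnm_lepP => j; rewrite mulmnE mnm1E.
  by case: eqVneq => [<-|]; rewrite ?mul1n.
have degE : mdeg m = (mdeg (m - U_(i) *+ k i)%MM + k i)%N.
  by rewrite [in LHS]mE mdegD mdegMn mdeg1 mul1n.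
have [b hb Ib] : good ('X_[m - U_(i) *+ k i] * h i).
  apply: IHd; apply: leq_trans (_ : (mdeg (m - U_(i) *+ k i)%MM + k i <= d)%N).
    by apply: msize_leM; rewrite ?msizeX.
  by rewrite -degE -ltnS; apply: ha.
exists b => //; apply: ideal_trans Ib => //.
by rewrite {1}mE mpolyXD -mpolyXn -mulrBr; apply: idealMl.
Qed.

End FiniteCodimension.

(** * Graded reduction to powers of one variable *)

Section GradedReduction.
Context {F : fieldType} {N : nat}.
Local Notation A := {mpoly F[N]}.
Implicit Types (a b h : A) (I P : set A).

(** The coefficient matrix has more rows than columns, hence a nonzero left kernel. *)
Lemma dependent_family k (T : finType) (b : T -> A) :
  (forall l, (msize (b l) <= k)%N) -> (#|{: 'X_{1..N < k}}| < #|T|)%N ->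
  exists2 g : T -> F, (exists l, g l != 0) & \sum_l g l *: b l = 0.
Proof.
move=> hb ltT.
pose M : 'M[F]_(#|T|, #|{: 'X_{1..N < k}}|) :=
  \matrix_(i, j) (b (enum_val i))@_(enum_val j : 'X_{1..N < k}).
have : kermx M != 0.
  rewrite -mxrank_eq0 mxrank_ker subn_eq0 -ltnNge.
  exact: leq_ltn_trans (rank_leq_col M) ltT.
case/rowV0Pn => v /sub_kermxP vM v0.
exists (fun l => v 0 (enum_rank l)).
  by case/rV0Pn: v0 => i vi; exists (enum_val i); rewrite enum_valK.
apply/mpolyP => m; rewrite mcoeff0 linear_sum /=.
have [ltm|gem] := ltnP (mdeg m) k; last first.
  rewrite big1 // => l _; rewrite mcoeffZ [X in _ * X]memN_msupp_eq0 ?mulr0 //.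
  by apply/msize_mdeg_ge; apply: leq_trans gem.
have := congr1 (fun w : 'rV_ _ => w 0 (enum_rank (BMultinom ltm))) vM.
rewrite !mxE => {2}<-; rewrite (reindex_onto enum_val enum_rank) /=; last first.
  by move=> l _; rewrite enum_rankK.
under eq_bigl => i do rewrite enum_valK eqxx.
by apply: eq_bigr => i _; rewrite mcoeffZ !mxE enum_rankK enum_valK.
Qed.

(** All variables are nilpotent modulo [P] and ['X_j], so modulo [P] a form of degree above [c] is
    ['X_j] times a form of degree one less. The graded pieces modulo [P] thus have bounded
    dimension. *)
Lemma homog_reduce P j : is_ideal P -> (forall a d, P a -> P (hc d a)) ->
  (forall i, exists k, ideal_plus P 'X_j ('X_i ^+ k)) ->
  exists c, forall d a, a \is d.-homog -> (c <= d)%N ->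
    exists2 b, (msize b <= c.+1)%N & P (a - 'X_j ^+ (d - c) * b).
Proof.
move=> idP hP /choice[k Pk]; exists (\sum_i k i)%N; set c := (\sum_i k i)%N.
have step d a : (c <= d)%N -> a \is d.+1.-homog ->
    exists2 a', a' \is d.-homog & P (a - 'X_j * a').
  move=> cd /dhomogP ha.
  (* Membership in the support sits under the existential so that [choice] applies to all monomials
     at once. *)
  suff H m : exists a', m \in msupp a -> a' \is d.-homog /\ P ('X_[m] - 'X_j * a').
    have {H}[f fP] := choice H.
    exists (\sum_(m <- msupp a) a@_m *: f m).
      rewrite big_seq; apply: rpred_sum => m ma; apply: rpredZ.
      by case: (fP m ma).
    rewrite {1}(mpolyE a) mulr_sumr -sumrB; apply: ideal_sum_seq => // m ma.
    rewrite -scalerAr -scalerBr -mul_mpolyC; apply: idealMl => //.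
    by case: (fP m ma).
  have [ma|_] := boolP (m \in msupp a); last by exists 0.
  have degm : mdeg m = d.+1 := ha _ ma.
  have [i kmi] : exists i, (k i <= m i)%N.
    apply/existsP; apply: contraLR cd => /existsPn kn.
    rewrite -ltnNge -ltnS -[d.+1]degm mdegE ltnS; apply: leq_sum => i _.
    by apply: ltnW; rewrite ltnNge; apply: kn.
  have mE : m = ((m - U_(i) *+ k i) + U_(i) *+ k i)%MM.
    rewrite submK //; apply/mnm_lepP => l; rewrite mulmnE mnm1E.
    by case: eqVneq => [<-|]; rewrite ?mul1n.
  have [y Py] := Pk i; set m' := (m - _)%MM in mE.
  (* Only the degree [d] component of the cofactor is kept; the congruence survives because [P] is
     homogeneous. *)
  exists (hc d ('X_[m'] * y)) => _; split; first exact: pihomogP.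
  have hX : ('X_j : A) \is 1.-homog by rewrite dhomogX; apply/eqP/mdeg1.
  have -> : 'X_[m] - 'X_j * hc d ('X_[m'] * y) = hc d.+1 ('X_[m] - 'X_j * ('X_[m'] * y)).
    rewrite linearB /= (hc_homogM d.+1 _ hX) subn1 /= [hc d.+1 'X_[m]]pihomog_dE //.
    by rewrite dhomogX; apply/eqP.
  apply: hP; rewrite {1}mE mpolyXD -mpolyXn mulrCA -mulrBr; apply: idealMl => //.
  by rewrite mulrC.
have main e a : a \is (c + e).-homog ->
    exists2 b, (msize b <= c.+1)%N & P (a - 'X_j ^+ e * b).
  elim: e a => [|e IHe] a; first rewrite addn0 => ha.
    by exists a; rewrite ?mul1r ?subrr ?homog_msize_le; case: idP.
  rewrite addnS => ha; have [a' ha' Pa'] := step _ _ (leq_addr _ _) ha.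
  have [b hb Pb] := IHe _ ha'; exists b => //.
  apply: ideal_trans Pa' _ => //; rewrite exprS -mulrA -mulrBr.
  exact: idealMl.

by move=> d a ha cd; apply: main; rewrite subnKC.
Qed.

(** The [D + 1] forms [a l] have the same degree and reduce to ['X_j ^+ (2 * D)] times polynomials
    from a space of dimension [D], so they are dependent modulo the homogeneous part. Replacing [u]
    by ['X_j], which is allowed modulo [P], turns the relation into an equation for ['X_j]. *)
Lemma algebraic_of_reduce P j u c : is_ideal P -> u \is 2.-homog -> P (u - 'X_j) ->
  (forall d a, a \is d.-homog -> (c <= d)%N ->
    exists2 b, (msize b <= c.+1)%N & hcore P (a - 'X_j ^+ (d - c) * b)) ->
  exists2 p, p != 0 & P (horner_alg 'X_j p).
Proof.
move=> idP hu Pu red; pose D := #|{: 'X_{1..N < c.+1}}|.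
have hX : ('X_j : A) \is 1.-homog by rewrite dhomogX; apply/eqP/mdeg1.
pose a (l : 'I_D.+1) := u ^+ l * 'X_j ^+ (2 * (D - l) + c).
have ha l : a l \is (c + 2 * D).-homog.
  have -> : (c + 2 * D)%N = (2 * l + 1 * (2 * (D - l) + c))%N.
    by have := ltn_ord l; lia.
  by apply: dhomogM; apply: dhomogMn.
have : forall l, exists b, (msize b <= c.+1)%N /\ hcore P (a l - 'X_j ^+ (2 * D) * b).
  move=> l; have [|b hb Pb] := red _ _ (ha l); first exact: leq_addr.
  by exists b; split=> //; move: Pb; rewrite addKn.
case/choice=> b bP.
have [//||g [l0 gl0] gb] := @dependent_family c.+1 'I_D.+1 b.
- by move=> l; case: (bP l).
- by rewrite card_ord.
exists (\sum_l g l *: 'X^(l + (2 * (D - l) + c))).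
  (* The exponents equal 2D + c - l and are pairwise distinct, so the coefficient [g l0]
     survives. *)
  apply/eqP => /(congr1 (fun p : {poly F} => p`_(l0 + (2 * (D - l0) + c)))).
  rewrite coef_sum coef0 (bigD1 l0) //= coefZ coefXn eqxx mulr1 big1 => [|l ne].
    by rewrite addr0 => /eqP; apply/negP.
  rewrite coefZ coefXn; case: eqVneq => [E|]; last by rewrite mulr0.
  case/eqP: ne; apply/val_inj => /=; have := ltn_ord l; have := ltn_ord l0; lia.
rewrite linear_sum /=.
apply: (ideal_congr (b := \sum_l g l *: a l)) => //.
  rewrite -sumrB; apply: ideal_sum => // l _.
  rewrite linearZ /= rmorphXn /= horner_algX -scalerAl mul1r -scalerBr -mul_mpolyC.
  apply: idealMl => //; rewrite exprD -mulrBl; apply: idealMr => //.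
  by apply: ideal_congrX => //; apply: ideal_sym.
apply: (homog_ideal_elt idP).
have -> : \sum_l g l *: a l = \sum_l (g l)%:MP * (a l - 'X_j ^+ (2 * D) * b l).
  under [RHS]eq_bigr => l _ do rewrite mulrBr [X in _ - X]mulrCA !mul_mpolyC.
  by rewrite sumrB -mulr_sumr gb mulr0 subr0.
have idPh := hcore_ideal idP; apply: (ideal_sum _ idPh) => l _.
by apply: (idealMl _ idPh); case: (bP l).
Qed.

End GradedReduction.

(** * The ideal of affine fixed points of the gradient *)

Lemma dhomog_mderiv (F : fieldType) (N d : nat) (f : {mpoly F[N]}) i :
  f \is d.+1.-homog -> f^`M(i) \is d.-homog.
Proof.
move/dhomogP => hf; apply/dhomogP => m.
rewrite mcoeff_msupp mcoeff_deriv => fm.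
have : (m + U_(i))%MM \in msupp f.
  by rewrite mcoeff_msupp; apply: contraNneq fm => ->; rewrite mul0rn.
by move/hf => /=; rewrite mdegD mdeg1 addn1 => -[].
Qed.

Definition fix_ideal (F : fieldType) (N : nat) (f : {mpoly F[N]}) : set {mpoly F[N]} :=
  ideal_gen (fun i : 'I_N => f^`M(i) - 'X_i).

Section RegularEigenscheme.
Context {R : realType} {n : nat}.
Local Notation A := {mpoly R[i][n.+1]}.
Implicit Types (f a : A) (I P : set A).

Lemma X_homog i : ('X_i : A) \is 1.-homog.
Proof. by rewrite dhomogX; apply/eqP/mdeg1. Qed.

Lemma proj_ptP I P : proj_pt I P <->
  [/\ is_prime P, homog_ideal P, I `<=` P & exists i, ~ P 'X_i].
Proof.
have mP a : (a \in mem P) <-> P a by split=> [/set_mem|/mem_set].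
split=> -[].
  move=> [/mP id0 /negP id1 idP] prP hP IP nX; split=> //; split; first split=> //.
  - by move=> a b Pa Pb; apply/mP; rewrite -[a]mul1r; apply: idP; apply/mP.
  - by move=> a b Pb; apply/mP; rewrite -[a * b]addr0; apply: idP; apply/mP.
  - by move/mP.
  - by move=> a b /mP/prP/orP[/mP|/mP]; [left | right].
move=> [idP P1 prP] hP IP nX; split=> //.
  split; first by apply/mP; case: idP.
    by apply/negP => /mP.
  by move=> a b c /mP Pb /mP Pc; apply/mP; apply: idealD => //; apply: idealMl.
by move=> a b /mP/prP[/mP|/mP] H; apply/orP; [left | right].
Qed.

Lemma eigen_ideal_fix f : eigen_ideal f `<=` fix_ideal f.
Proof.
have idI := ideal_gen_ideal (fun i : 'I_n.+1 => f^`M(i) - 'X_i).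
apply: ideal_gen_sub => // -[i j] /=.
rewrite (_ : _ - _ = 'X_i * (f^`M(j) - 'X_j) - 'X_j * (f^`M(i) - 'X_i)); last by ring.
by apply: idealB => //; apply: idealMl => //; apply: (ideal_gen_mem (fun i => f^`M(i) - 'X_i)).
Qed.

(** Testing the saturation on the constant family q_i puts a q_i^k in [P], while q_i is outside the
    prime [P]. *)
Lemma reg_ideal_sub f P i : is_prime P -> eigen_ideal f `<=` P -> ~ P f^`M(i) ->
  reg_ideal f `<=` P.
Proof.
move=> prP EP nPq a [k sk]; have [_ _ pr] := prP.
have /EP := sk (fun=> f^`M(i)) (fun=> ideal_gen_mem (fun i => f^`M(i)) i).
by rewrite prodr_const card_ord => /pr[//|/(prime_exp prP)].
Qed.

Lemma eigen_ideal_hcore f P : f \is 3.-homog -> is_ideal P -> fix_ideal f `<=` P ->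
  eigen_ideal f `<=` hcore P.
Proof.
move=> hf idP IP; apply: ideal_gen_sub => [|[i j] /=]; first exact: hcore_ideal.
apply: (@hcore_homog _ _ _ _ 3) => //.
  by apply: rpredB; apply: (@dhomogM _ _ _ 1 _ 2); rewrite ?X_homog ?dhomog_mderiv.
by apply/IP/eigen_ideal_fix; apply: (ideal_gen_mem (fun ij : 'I_n.+1 * 'I_n.+1 =>
  'X_(ij.1) * f^`M(ij.2) - 'X_(ij.2) * f^`M(ij.1)) (i, j)).
Qed.

Lemma fix_ideal_fincodim f : f \is 3.-homog -> proj_dim_le (reg_ideal f) 0 ->
  exists c, fincodim (fix_ideal f) c.
Proof.
move=> hf [_ dim0].
have idI : is_ideal (fix_ideal f) := ideal_gen_ideal _.
apply: fincodim_of_leading => // j; apply: contrapT => nolead.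
(* A prime avoiding all nonzero polynomials in ['X_j] makes ['X_j] transcendental. *)
pose S := [set a : A | exists2 p : {poly R[i]}, p != 0 & a = horner_alg 'X_j p].
have [|a b|a|P [prP IP PS]] := prime_avoiding (S := S) idI.
- by exists 1; rewrite ?oner_eq0 ?rmorph1.
- by move=> [p p0 ->] [q q0 ->]; exists (p * q); rewrite ?mulf_neq0 ?rmorphM.
- by move=> [p p0 ->] Ip; apply: nolead; apply: leading_of_algebraic Ip.
have [idP _ _] := prP.
have Pq i : P (f^`M(i) - 'X_i).
  by apply: IP; apply: (ideal_gen_mem (fun i => f^`M(i) - 'X_i)).
have nPX : ~ P 'X_j.
  by apply: PS; exists 'X; rewrite ?polyX_eq0 //= horner_algX.
have nPq : ~ P f^`M(j).
  by move=> Pqj; apply: nPX; apply: ideal_congr Pqj => //; apply: ideal_sym.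
have prPh := hcore_prime prP; have [idPh _ _] := prPh.
have regP : reg_ideal f `<=` hcore P.
  apply: (@reg_ideal_sub _ _ j) => //; first exact: eigen_ideal_hcore.
  by move/(homog_ideal_elt idP).
(* Otherwise a prime [Q] containing P^h and ['X_j] but no power of ['X_i] gives a chain of two
   points of Reg(f), against dimension at most 0. The inclusion is strict because ['X_j] lies in Q^h
   only. *)
have Xpow i : exists k, ideal_plus (hcore P) 'X_j ('X_i ^+ k).
  apply: contrapT => nopow.
  have [idPX PX Xj] := ideal_plusP 'X_j idPh.
  pose T := [set a : A | exists k, a = 'X_i ^+ k].
  have [|a b|a|Q [prQ PQ QT]] := prime_avoiding (S := T) idPX.
  - by exists 0%N; rewrite expr0.
  - by move=> [k ->] [l ->]; exists (k + l)%N; rewrite exprD.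
  - by move=> [k ->] Pk; apply: nopow; exists k.
  have [idQ _ _] := prQ.
  have PQh : hcore P `<=` hcore Q.
    by move=> a Pa; apply: (@hcore_sub _ _ (hcore P)) Pa => //;
       [move=> b d; apply: hcore_hc | exact: subset_trans PQ].
  have nPhX : ~ hcore P 'X_j by move/(homog_ideal_elt idP).
  have : proj_chain (reg_ideal f) 1.
    exists (fun k => if k is 0 then hcore P else hcore Q); split.
      case=> [|k] _; apply/proj_ptP; split=> //.
      - by move=> a d; apply: hcore_hc.
      - by exists j.
      - exact: hcore_prime.
      - by move=> a d; apply: hcore_hc.
      - exact: subset_trans PQh.
      - by exists i => /(homog_ideal_elt idQ); apply: QT; exists 1%N.
    case=> // _; split => // QP; apply: nPhX; apply: QP.
    by apply: hcore_homog (X_homog j) (PQ _ Xj).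
  by move/dim0.
have [c redc] := homog_reduce idPh (fun a d => @hcore_hc _ _ P a d idP) Xpow.
have [|p p0 Pp] := algebraic_of_reduce idP _ (Pq j) redc.
  exact: dhomog_mderiv.
by apply: PS Pp; exists p.
Qed.

End RegularEigenscheme.

(** * Zeros of quadrics *)

(** The passage to the limit d -> oo, within the natural numbers. If t > B, iterating the inequality
    forces [s] to grow exponentially, against the bound by a power. *)
Lemma ratio_le_of_growth (s : nat -> nat) (t B c N : nat) :
  (forall d, t * s d <= B * s (d + c))%N -> (0 < s 1)%N ->
  (forall k, s k <= k ^ N)%N -> (t <= B)%N.
Proof.
move=> ts s1 sN; rewrite leqNgt; apply/negP => ltBt.
have B0 : (0 < B)%N.
  rewrite lt0n; apply/negP => /eqP B0; have := ts 1%N; rewrite B0 mul0n leqn0.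
  by rewrite muln_eq0 => /orP[/eqP|/eqP]; lia.
have iter k : (B.+1 ^ k * s 1 <= B ^ k * s (1 + k * c))%N.
  elim: k => [|k IHk]; first by rewrite mul0n addn0.
  have step : (B.+1 * s (1 + k * c) <= B * s (1 + k.+1 * c))%N.
    have -> : (1 + k.+1 * c = 1 + k * c + c)%N by rewrite mulSn; lia.
    by apply: leq_trans (ts _); rewrite leq_mul2r ltBt orbT.
  rewrite !expnS -!mulnA; apply: leq_trans (_ : B.+1 * (B ^ k * s (1 + k * c)) <= _)%N.
    by rewrite leq_mul2l IHk orbT.
  by rewrite mulnCA [leqRHS]mulnCA leq_mul2l step orbT.
(* Bernoulli's inequality for (1 + 1/B)^j with denominators cleared; j = B yields a factor 2. *)
have bern j : (B ^ j * (B + j) <= B.+1 ^ j * B)%N.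
  elim: j => [|j IHj]; first by rewrite addn0.
  rewrite !expnS -!mulnA; apply: leq_trans (_ : B.+1 * (B ^ j * (B + j)) <= _)%N.
    rewrite mulnCA [leqRHS]mulnCA leq_mul2l; apply/orP; right; nia.
  by rewrite leq_mul2l IHj orbT.
have two : (2 * B ^ B <= B.+1 ^ B)%N.
  by rewrite -(leq_pmul2r B0); apply: leq_trans (bern B); rewrite addnn -mul2n; lia.
(* Iterating B M r times gains a factor 2^(M r). [M] is positive, so an M-th root gives 2^r <= 1 + r
   E; the chosen [r] makes 2^r at least (2E + 2)^2, which exceeds 1 + r E. *)
pose M := N.+1; pose E := (B * M * c)%N; pose r := (2 * (2 * E).+1)%N.
have key : (2 ^ r <= 1 + r * E)%N.
  rewrite -(leq_exp2r _ _ (ltn0Sn N)) -/M.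
  rewrite -(@leq_pmul2l (B ^ (B * (M * r)))) ?expn_gt0 ?B0 //.
  apply: leq_trans (_ : B.+1 ^ (B * (M * r)) <= _)%N.
    rewrite -(expnM 2%N) [(r * M)%N]mulnC ![(_ ^ (B * _))%N]expnM mulnC -expnMn.
    by rewrite leq_exp2r.
  apply: leq_trans (_ : B.+1 ^ (B * (M * r)) * s 1 <= _)%N; first by rewrite leq_pmulr.
  apply: leq_trans (iter _) _; rewrite leq_mul2l; apply/orP; right.
  apply: leq_trans (sN _) _.
  apply: leq_trans (_ : (1 + r * E) ^ N <= _)%N; last by rewrite leq_pexp2l //; lia.
  have -> : (B * (M * r) * c = r * E)%N by rewrite /E; lia.
  by [].
have pow4 j : (j.+1 ^ 2 <= 2 ^ (2 * j))%N.
  by rewrite mulnC expnM leq_exp2r //; apply: ltn_expl.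
have := leq_trans (pow4 (2 * E).+1) key; rewrite /r; nia.
Qed.

(** Membership in the d-th power of the ideal of the origin, read off on monomials. *)
Definition ord_ge (F : fieldType) (N d : nat) (a : {mpoly F[N]}) : Prop :=
  forall m, m \in msupp a -> (d <= mdeg m)%N.

(** Taylor expansion at [v]: the order of vanishing at [v] becomes an order at the origin. *)
Definition translate (F : fieldType) (N : nat) (v : 'rV[F]_N) : {mpoly F[N]} -> {mpoly F[N]} :=
  mmap (@mpolyC N F) (fun i => 'X_i + (v 0 i)%:MP).

Section Multiplicity.
Context {F : fieldType} {N : nat}.
Local Notation A := {mpoly F[N]}.
Implicit Types (a b u : A) (v w : 'rV[F]_N).

Lemma ord_ge0 a : ord_ge 0 a. Proof. by []. Qed.

Lemma ord_ge_zero d : ord_ge d (0 : A).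
Proof. by move=> m; rewrite msupp0. Qed.

Lemma ord_geD d a b : ord_ge d a -> ord_ge d b -> ord_ge d (a + b).
Proof. by move=> ha hb m /msuppD_le; rewrite mem_cat => /orP[/ha|/hb]. Qed.

Lemma ord_geM d e a b : ord_ge d a -> ord_ge e b -> ord_ge (d + e) (a * b).
Proof.
move=> ha hb m /msuppM_le /allpairsP[[m1 m2] /= [/ha h1 /hb h2 ->]].
by rewrite mdegD leq_add.
Qed.

Lemma ord_geMl d a b : ord_ge d b -> ord_ge d (a * b).
Proof. exact: (@ord_geM 0 d a b). Qed.

Lemma ord_geX d a : ord_ge 1 a -> ord_ge d (a ^+ d).
Proof.
move=> ha; elim: d => [|d IHd]; first exact: ord_ge0.
by rewrite exprS -add1n; apply: ord_geM.
Qed.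

Lemma ord_geB d a b : ord_ge d a -> ord_ge d b -> ord_ge d (a - b).
Proof. by move=> ha hb; rewrite -mulN1r; apply: ord_geD => //; apply: ord_geMl. Qed.

Lemma ord_ge_sum d (T : Type) (r : seq T) (p : pred T) (f : T -> A) :
  (forall i, p i -> ord_ge d (f i)) -> ord_ge d (\sum_(i <- r | p i) f i).
Proof.
move=> hf; apply: (big_ind (ord_ge d)) => //; first exact: ord_ge_zero.
exact: ord_geD.
Qed.

Lemma ord_ge1 a : a@_0%MM = 0 -> ord_ge 1 a.
Proof.
move=> a0 m ma; rewrite lt0n mdeg_eq0; apply/eqP => m0.
by move: ma; rewrite m0 mcoeff_msupp a0 eqxx.
Qed.

(** A polynomial with nonzero constant term [x] is a unit modulo order [d]: with y = x - u of order
    at least 1, [u] divides x^d - y^d. *)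
Lemma ord_ge_cancel d u a : u@_0%MM != 0 -> ord_ge d (u * a) -> ord_ge d a.
Proof.
set x := u@_0%MM => x0 hua; pose y := x%:MP - u.
have hy : ord_ge 1 y by apply: ord_ge1; rewrite mcoeffB mcoeffC eqxx mulr1 subrr.
have xa : ord_ge d ((x%:MP) ^+ d * a).
  have -> : (x%:MP) ^+ d * a = ((x%:MP) ^+ d - y ^+ d) * a + a * y ^+ d by ring.
  apply: ord_geD; last by apply: ord_geMl; apply: ord_geX.
  rewrite subrXX (_ : x%:MP - y = u); last by rewrite /y; ring.
  by rewrite -mulrAC mulrC; apply: ord_geMl.
have -> : a = ((x ^+ d)^-1)%:MP * ((x%:MP) ^+ d * a).
  have -> : x%:MP ^+ d = (x ^+ d)%:MP :> A by rewrite rmorphXn.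
  by rewrite mulrA -mpolyCM mulVf ?expf_neq0 // mul1r.
exact: ord_geMl.
Qed.

HB.instance Definition _ v := GRing.RMorphism.on (translate v).

Lemma translateX v i : translate v 'X_i = 'X_i + (v 0 i)%:MP.
Proof. by rewrite /translate mmapX mmap1U. Qed.

Lemma translateC v x : translate v x%:MP = x%:MP.
Proof. exact: mmapC. Qed.

Lemma translateZ v x a : translate v (x *: a) = x *: translate v a.
Proof. by rewrite -!mul_mpolyC rmorphM /= translateC. Qed.

Lemma translate_coef0 v a : (translate v a)@_0%MM = a.@[fun i => v 0 i].
Proof.
rewrite /translate /mmap mevalE linear_sum /=; apply: eq_bigr => m _.
rewrite mcoeffCM; congr (_ * _); rewrite rmorph_prod /=; apply: eq_bigr => i _.
rewrite rmorphXn /=; congr (_ ^+ _).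
by rewrite mcoeffD mcoeffX mcoeffC eqxx mulr1 mnm1_eq0 add0r.
Qed.

(** With [s k] the number of monomials of degree below [k], jets at the zeros give
    [#|T| * s d <= s (c + 2 * d)], and halving exponents gives [s (c + 2 * d) <= 2 ^ N * s (d + c)].
    The latter replaces binomial asymptotics. *)
Lemma fincodim_zeros (T : finType) (v : T -> 'rV[F]_N) (J : finType) (g : J -> A) c :
  injective v -> fincodim (ideal_gen g) c -> (forall i, (msize (g i) <= 3)%N) ->
  (forall t i, (g i).@[fun j => v t 0 j] = 0) -> (#|T| <= 2 ^ N)%N.
Proof.
move=> v_inj fc gdeg gv.
pose K d a := forall t, ord_ge d (translate (v t) a).
(* One more order of vanishing costs two degrees: the coefficients [h i] are reduced by induction,
   and [g i] has degree at most 2 and vanishes at all the points. *)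
have filt d a : exists2 b, (msize b <= c + 2 * d)%N & K d (a - b).
  elim: d a => [|d IHd] a; first by exists 0; rewrite ?msize0.
  have [b0 hb0 [h ab0]] := fc a.
  have /choice[b bP] : forall i, exists b, (msize b <= c + 2 * d)%N /\ K d (h i - b).
    by move=> i; have [b hb Kb] := IHd (h i); exists b.
  exists (b0 + \sum_i b i * g i).
    apply: msize_leD; first by rewrite (leq_trans hb0) ?leq_addr.
    apply: msize_le_sum => i _; have [hb _] := bP i.
    by rewrite mulrC mulnS addnCA; apply: msize_leM.
  move=> t; rewrite opprD addrA ab0 -sumrB rmorph_sum /=; apply: ord_ge_sum => i _.
  rewrite -mulrBl rmorphM /= -addn1; apply: ord_geM; first by case: (bP i).
  by apply: ord_ge1; rewrite translate_coef0 gv.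
pose s k := #|{: 'X_{1..N < k}}|.
have count d : (#|T| * s d <= s (c + 2 * d))%N.
  have [l lP] : exists l : T -> T -> A, forall t t', t != t' ->
      (l t t').@[fun i => v t 0 i] = 0 /\ (l t t').@[fun i => v t' 0 i] != 0.
    suff H t t' : exists l : A, t != t' ->
        l.@[fun i => v t 0 i] = 0 /\ l.@[fun i => v t' 0 i] != 0.
      have /choice[l lP] : forall t, exists l : T -> A, forall t', t != t' ->
          (l t').@[fun i => v t 0 i] = 0 /\ (l t').@[fun i => v t' 0 i] != 0.
        by move=> t; have [l lP] := choice (H t); exists l.
      by exists l.
    have [->|ne] := eqVneq t t'; first by exists 0.
    have [i vi] : exists i, v t' 0 i != v t 0 i.
      apply/existsP; apply: contraNT ne => /existsPn eqv; apply/eqP/v_inj/rowP => i.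
      by have := eqv i; rewrite negbK => /eqP.
    exists ('X_i - (v t 0 i)%:MP) => _.
    by rewrite !mevalB !mevalXU !mevalC subrr subr_eq0.
  (* [e t] vanishes to order [d] at all other points and not at [v t], so it isolates the jet at
     [v t]. *)
  pose e t := \prod_(t' | t' != t) l t' t ^+ d.
  have e_far t t' : t' != t -> ord_ge d (translate (v t') (e t)).
    move=> ne; rewrite /e (bigD1 t') //= rmorphM /= mulrC; apply: ord_geMl.
    rewrite rmorphXn /=; apply/ord_geX/ord_ge1; rewrite translate_coef0.
    by case: (lP _ _ ne).
  have e_near t : (translate (v t) (e t))@_0%MM != 0.
    rewrite translate_coef0 /e rmorph_prod /=; apply/prodf_neq0 => t' ne.
    by rewrite rmorphXn /= expf_neq0 //; case: (lP _ _ ne).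
  pose mon t (m : 'X_{1..N}) := \prod_i ('X_i - (v t 0 i)%:MP) ^+ m i : A.
  have monE t m : translate (v t) (mon t m) = 'X_[m].
    rewrite /mon rmorph_prod /= mpolyXE_id; apply: eq_bigr => i _.
    by rewrite rmorphXn rmorphB /= translateX translateC addrK.
  (* If there were more products [e t * mon t m] than monomials available for their reductions, a
     nontrivial combination of these products would vanish to order [d] at every point. *)
  rewrite leqNgt; apply/negP => lt.
  have : forall p : T * 'X_{1..N < d}, exists b : A,
      (msize b <= c + 2 * d)%N /\ K d (e p.1 * mon p.1 p.2 - b).
    by move=> p; have [b hb Kb] := filt d (e p.1 * mon p.1 p.2); exists b.
  case/choice => b bP.
  have [||x [[t m] xtm] xb] := @dependent_family _ _ (c + 2 * d) _ b.
  - by move=> p; case: (bP p).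
  - by rewrite card_prod.
  pose y t := \sum_(m : 'X_{1..N < d}) x (t, m) *: mon t m.
  have : ord_ge d (translate (v t) (\sum_t' e t' * y t')).
    have -> : \sum_t' e t' * y t' = \sum_p x p *: (e p.1 * mon p.1 p.2 - b p).
      under [RHS]eq_bigr => p _ do rewrite scalerBr.
      rewrite sumrB xb subr0 [RHS](eq_bigr (fun p => x (p.1, p.2) *: (e p.1 * mon p.1 p.2))); last by case.
      rewrite -(pair_bigA _ (fun t m => x (t, m) *: (e t * mon t m))) /=.
      apply: eq_bigr => t' _; rewrite /y mulr_sumr; apply: eq_bigr => m' _.
      by rewrite scalerAr.
    rewrite rmorph_sum /=; apply: ord_ge_sum => p _.
    by rewrite translateZ -mul_mpolyC; apply: ord_geMl; case: (bP p).
  rewrite (bigD1 t) //= rmorphD /= => near.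
  have {near} : ord_ge d (translate (v t) (e t) * translate (v t) (y t)).
    rewrite -rmorphM /= -(addrK (translate (v t) (\sum_(t' | t' != t) e t' * y t'))
      (translate _ _)); apply: ord_geB => //.
    rewrite rmorph_sum /=; apply: ord_ge_sum => t' ne.
    by rewrite rmorphM /= mulrC; apply: ord_geMl; apply: e_far; rewrite eq_sym.
  (* Once the local unit [e t] is cancelled, a polynomial of degree below [d] and order at least [d]
     remains, so its coefficient [x (t, m)] is zero. *)
  move/(ord_ge_cancel (e_near t)) => /(_ m).
  have -> : translate (v t) (y t) = \sum_(m : 'X_{1..N < d}) x (t, m) *: 'X_[m].
    by rewrite rmorph_sum; apply: eq_bigr => m' _; rewrite /= translateZ monE.
  rewrite mcoeff_msupp linear_sum (bigD1 m) //= mcoeffZ mcoeffX eqxx mulr1 big1.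
    by rewrite addr0 => /(_ xtm); rewrite leqNgt bmdeg.
  move=> m' ne; rewrite mcoeffZ mcoeffX (_ : _ == _ = false) ?mulr0 //.
  by apply/negbTE; rewrite -bmeqP.
(* A monomial is determined by the parities of its exponents together with their halves. *)
have halving d : (s (c + 2 * d) <= 2 ^ N * s (d + c))%N.
  have hm (m : 'X_{1..N < c + 2 * d}) : (mdeg [multinom (m i)./2 | i < N] < d + c)%N.
    have : (mdeg [multinom (m i)./2 | i < N] * 2 <= mdeg m)%N.
      rewrite !mdegE big_distrl /=; apply: leq_sum => i _; rewrite mnmE.
      by rewrite -[leqRHS](odd_double_half (m i)) muln2 leq_addl.
    have := bmdeg m; lia.
  pose h (m : 'X_{1..N < c + 2 * d}) : {ffun 'I_N -> bool} * 'X_{1..N < d + c} :=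
    ([ffun i => odd (m i)], BMultinom (hm m)).
  have h_inj : injective h.
    move=> m1 m2 E; apply/val_inj/mnmP => i /=.
    have /ffunP odds := congr1 fst E.
    have halves : [multinom (m1 j)./2 | j < N] = [multinom (m2 j)./2 | j < N] :=
      congr1 (fun p : _ * 'X_{1..N < d + c} => bmnm p.2) E.
    rewrite -(odd_double_half (m1 i)) -(odd_double_half (m2 i)).
    have := odds i; rewrite !ffunE => ->.
    by have := congr1 (fun m : 'X_{1..N} => m i) halves; rewrite !mnmE => ->.
  by have := leq_card _ h_inj; rewrite card_prod card_ffun card_bool card_ord.
apply: (@ratio_le_of_growth s _ _ c N).
- by move=> d; apply: leq_trans (count d) (halving d).
- have h0 : (mdeg (0%MM : 'X_{1..N}) < 1)%N by rewrite mdeg0.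
  by apply/card_gt0P; exists (BMultinom h0).
case=> [|k].
  by rewrite /s eq_card0 // => m; have := bmdeg m; rewrite ltn0.
have hm (m : 'X_{1..N < k.+1}) i : (m i < k.+1)%N.
  by apply: leq_ltn_trans (bmdeg m); rewrite mdegE (bigD1 i) //= leq_addr.
pose h (m : 'X_{1..N < k.+1}) : {ffun 'I_N -> 'I_k.+1} := [ffun i => Ordinal (hm m i)].
have h_inj : injective h.
  move=> m1 m2 /ffunP E; apply/val_inj/mnmP => i /=.
  by have := congr1 val (E i); rewrite !ffunE.
by have := leq_card _ h_inj; rewrite card_ffun !card_ord.
Qed.

End Multiplicity.

(** * The bound on regular eigenpoints *)

Lemma card_le_of_families (T : choiceType) (A : set T) (m : nat) :
  (forall (S : finType) (g : S -> T), injective g -> (forall s, A (g s)) ->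
    (#|S| <= m)%N) -> (A #<= `I_m)%card.
Proof.
move=> H.
have Hfset (B : {fset T}) : [set` B] `<=` A -> (#|` B| <= m)%N.
  by move=> BA; rewrite cardfE; apply: (H _ val val_inj) => b; apply/BA/fsvalP.
have finA : finite_set A.
  apply: contrapT => /(infinite_set_fset m.+1)[B /Hfset leB ltB].
  by have := leq_trans ltB leB; rewrite ltnn.
have [k Ak] := (finite_setP A).1 finA; rewrite (card_le_eql Ak) card_le_II.
by rewrite -(card_fset_set Ak); apply: Hfset; rewrite fset_setK.
Qed.

Section Bound.
Context {R : realType} {n : nat}.
Local Notation C := R[i].
Implicit Types (f : {mpoly C[n.+1]}) (v w : 'rV[C]_n.+1).

Lemma meval_homogZ d (a : {mpoly C[n.+1]}) (x : C) v : a \is d.-homog ->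
  a.@[fun i => (x *: v) 0 i] = x ^+ d * a.@[fun i => v 0 i].
Proof.
move/dhomogP => ha; rewrite !mevalE mulr_sumr; apply: eq_big_seq => m ma.
under eq_bigr => i _ do rewrite mxE exprMn.
rewrite big_split /= mulrCA; congr (_ * (_ * _)).
by rewrite prodrXr -mdegE; congr (_ ^+ _); apply: ha.
Qed.

Lemma grad_homogZ d f x v : f \is d.+1.-homog ->
  grad_at f (x *: v) = x ^+ d *: grad_at f v.
Proof.
move=> hf; apply/rowP => i; rewrite !mxE.
by apply: meval_homogZ; apply: dhomog_mderiv.
Qed.

(** The gradient is quadratic: if it sends [v] to x v with x nonzero, it fixes v / x. *)
Lemma regular_eigenpoint_fixed f p : f \is 3.-homog -> regular_eigenpoint f p ->
  exists w, [/\ val p = <[w]>%VS, w != 0 & grad_at f w = w].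
Proof.
move=> hf [v [pv gv0 gp]].
have /vlineP[x gE] : grad_at f v \in <[v]>%VS by rewrite -pv -gp memv_line.
have x0 : x != 0 by apply: contraNneq gv0 => x0; rewrite gE x0 scale0r.
have v0 : v != 0 by apply: contraNneq gv0 => v0; rewrite gE v0 scaler0.
exists (x^-1 *: v); split.
- rewrite pv; apply/eqP; rewrite eqEsubv -!memvE memvZ ?memv_line // andbT.
  by apply/vlineP; exists x; rewrite scalerA mulfV // scale1r.
- by rewrite scaler_eq0 invr_eq0 (negPf x0).
- rewrite (grad_homogZ _ _ hf) gE scalerA; congr (_ *: _).
  by rewrite expr2 -mulrA mulVf // mulr1.
Qed.

Lemma card_regular_eigenpoints f : f \is 3.-homog -> proj_dim_le (reg_ideal f) 0 ->
  ([set p | regular_eigenpoint f p] #<= `I_(2 ^ n.+1 - 1))%card.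
Proof.
move=> hf dim0; have [c fc] := fix_ideal_fincodim hf dim0.
apply: card_le_of_families => S p p_inj p_eig.
have /choice[w wP] := fun s => regular_eigenpoint_fixed hf (p_eig s).
(* [None] stands for the origin, the extra zero responsible for the [- 1] in the bound. *)
pose v (t : option S) := if t is Some s then w s else 0.
have v_inj : injective v.
  case=> [s|] [t|] //= E.
  - congr Some; apply/p_inj/val_inj.
    by have [-> _ _] := wP s; have [-> _ _] := wP t; rewrite E.
  - by have [_ /eqP] := wP s.
  - by have [_ /eqP + _] := wP t; rewrite -E.
have grad0 : grad_at f 0 = 0 by rewrite -[in LHS](scale0r 0) (grad_homogZ _ _ hf) expr0n /= !scale0r.
have gv t : grad_at f (v t) = v t by case: t => //= s; case: (wP s).
rewrite leq_subRL ?expn_gt0 // add1n -card_option.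
apply: fincodim_zeros v_inj fc _ _.
- move=> i; apply: msize_leD.
    exact: homog_msize_le (dhomog_mderiv _ hf).
  by rewrite mmeasureN msizeX mdeg1.
- move=> t i; have := congr1 (fun u : 'rV_ _ => u 0 i) (gv t).
  by rewrite !mxE mevalB mevalXU => ->; rewrite subrr.
Qed.

End Bound.

(** * Radical ideals and the ideal of the regular eigenscheme *)

Section Radical.
Context {F : fieldType} {N : nat}.
Local Notation A := {mpoly F[N]}.
Implicit Types (a b x g : A) (I J : set A) (v : 'rV[F]_N).

Lemma mpoly_ring_ind (P : A -> Prop) :
  (forall c, P c%:MP) -> (forall i, P 'X_i) ->
  (forall a b, P a -> P b -> P (a + b)) -> (forall a b, P a -> P b -> P (a * b)) ->
  forall a, P a.
Proof.
move=> PC PX PD PM a; rewrite (mpolyE a); apply: (big_ind P) => //.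
  by rewrite -mpolyC0.
move=> m _; rewrite -mul_mpolyC; apply: (PM) => //; rewrite mpolyXE_id.
apply: (big_ind P); [by rewrite -mpolyC1 | exact: PM | ].
move=> i _; elim: (m i) => [|k IHk]; first by rewrite expr0 -mpolyC1.
by rewrite exprS; apply: PM.
Qed.

Lemma prod_sub_eval (cs : seq F) x c : exists r,
  \prod_(c' <- cs) (x - c'%:MP) = (\prod_(c' <- cs) (c - c'))%:MP + r * (x - c%:MP).
Proof.
elim: cs => [|c' cs [r IHr]]; first by exists 0; rewrite !big_nil mpolyC1; ring.
exists (r * (x - c'%:MP) + (\prod_(c0 <- cs) (c - c0))%:MP).
by rewrite !big_cons IHr mpolyCM mpolyCB; ring.
Qed.

(** The elements x - c are pairwise comaximal, so lying in every I + (x - c) means lying in [I] plus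
    their product, which is [I]. *)
Lemma split_roots I (cs : seq F) x g : is_ideal I -> uniq cs ->
  I (\prod_(c <- cs) (x - c%:MP)) ->
  (forall c, c \in cs -> ideal_plus I (x - c%:MP) g) -> I g.
Proof.
elim: cs I => [|c cs IHcs] I idI.
  by move=> _; rewrite big_nil => I1 _; rewrite -[g]mulr1; apply: idealMl.
rewrite cons_uniq => /andP[ncs ucs]; rewrite big_cons.
set Q := \prod_(_ <- cs) _ => IQ Ig.
have [idJ subJ JQ] := ideal_plusP Q idI.
have [s Is] : ideal_plus I Q g.
  apply: IHcs => // c' c'cs; have [|y Iy] := Ig c'; first by rewrite inE c'cs orbT.
  by exists y; apply: subJ.
have [y Iy] := Ig c (mem_head _ _).
have [r QE] := prod_sub_eval cs x c; rewrite -/Q in QE.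
have Q0 : \prod_(c' <- cs) (c - c') != 0.
  rewrite prodf_seq_neq0; apply/allP => c' c'cs /=; rewrite subr_eq0.
  by apply: contraNneq ncs => ->.
set z := \prod_(c' <- cs) (c - c') in QE Q0.
(* [Q] is the nonzero constant [z] modulo x - c, so z g combines the membership modulo [Q] with that
   modulo x - c. *)
have : I (z%:MP * g).
  have -> : z%:MP * g = Q * (g - y * (x - c%:MP)) - r * (x - c%:MP) * (g - s * Q)
      + (y - r * s) * ((x - c%:MP) * Q).
    by rewrite (_ : z%:MP = Q - r * (x - c%:MP)) ?QE; ring.
  by do 2?apply: idealD => //; [|apply: idealN => //|]; apply: idealMl.
move/(idealMl z^-1%:MP idI); rewrite mulrA -mpolyCM mulVf // mpolyC1.
by rewrite mul1r.
Qed.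

Lemma meval_congr J v a : is_ideal J -> (forall i, J ('X_i - (v 0 i)%:MP)) ->
  J (a - (a.@[fun i => v 0 i])%:MP).
Proof.
move=> idJ Jv; elim/mpoly_ring_ind: a => [c|i|a b Ja Jb|a b Ja Jb].
- by rewrite mevalC subrr; case: idJ.
- by rewrite mevalXU.
- by rewrite mevalD mpolyCD opprD addrACA; apply: idealD.
- by rewrite mevalM mpolyCM; apply: ideal_congrM.
Qed.

(* Seidenberg's lemma for split polynomials. *)
Lemma radical_of_split I g : is_ideal I ->
  (forall i, exists2 cs, uniq cs & I (\prod_(c <- cs) ('X_i - c%:MP))) ->
  (forall v, (forall a, I a -> a.@[fun i => v 0 i] = 0) -> g.@[fun i => v 0 i] = 0) ->
  I g.
Proof.
move=> idI Isplit Ig.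
(* [s] lists the variables not yet known to be constant modulo [J]; they are specialized to roots
   one by one. *)
suff H (s : seq 'I_N) J : is_ideal J -> I `<=` J ->
    (forall i, i \notin s -> exists c, J ('X_i - c%:MP)) -> J g.
  by apply: (H (enum 'I_N) I) => // i; rewrite mem_enum.
elim: s J => [|i s IHs] J idJ IJ Jx.
  have /choice[w Jw] : forall i, exists c, J ('X_i - c%:MP) by move=> i; apply: Jx.
  pose v : 'rV[F]_N := \row_i w i.
  have Jv i : J ('X_i - (v 0 i)%:MP) by rewrite mxE.
  (* With all variables constant modulo [J], either [J] is the unit ideal or the constants form a
     zero of [I], where [g] vanishes. *)
  have [J1|nJ1] := pselect (J 1); first by rewrite -[g]mulr1; apply: idealMl.
  apply: ideal_congr (meval_congr g idJ Jv) _ => //.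
  rewrite Ig ?mpolyC0; first by case: idJ.
  move=> a /IJ Ja; apply/eqP; apply: contra_notT nJ1 => av0.
  have : J (a.@[fun i => v 0 i])%:MP.
    by apply: ideal_congr Ja => //; apply: ideal_sym => //; apply: meval_congr.
  move/(idealMl (a.@[fun i => v 0 i])^-1%:MP idJ).
  by rewrite -mpolyCM mulVf // mpolyC1.
have [cs ucs Ics] := Isplit i.
apply: (@split_roots J cs 'X_i) => //; first exact: IJ.
move=> c _; have [idJ' subJ' Jc] := ideal_plusP ('X_i - c%:MP) idJ.
apply: IHs => // [|k nks]; first exact: subset_trans subJ'.
have [->|ne] := eqVneq k i; first by exists c.
have [|c' Jc'] := Jx k; first by rewrite inE negb_or ne.
by exists c'; apply: subJ'.
Qed.

End Radical.

Section Substitution.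
Context {F : fieldType} {N M : nat}.
Implicit Types (a b : {mpoly F[N]}) (s t : 'I_N -> {mpoly F[M]}).

Definition subst s : {mpoly F[N]} -> {mpoly F[M]} := mmap (@mpolyC M F) s.

HB.instance Definition _ s := GRing.RMorphism.on (subst s).

Lemma substX s i : subst s 'X_i = s i.
Proof. by rewrite /subst mmapX mmap1U. Qed.

Lemma substC s c : subst s c%:MP = c%:MP.
Proof. exact: mmapC. Qed.

Lemma subst_congr (I : set {mpoly F[M]}) s t a : is_ideal I ->
  (forall i, I (s i - t i)) -> I (subst s a - subst t a).
Proof.
move=> idI st; elim/(@mpoly_ring_ind F N): a => [c|i|a b Ia Ib|a b Ia Ib].
- by rewrite !substC subrr; case: idI.
- by rewrite !substX.
- by rewrite !rmorphD /= opprD addrACA; apply: idealD.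
- by rewrite !rmorphM; apply: ideal_congrM.
Qed.

Lemma subst_homogM d a s y : a \is d.-homog ->
  subst (fun i => y * s i) a = y ^+ d * subst s a.
Proof.
move/dhomogP => ha; rewrite /subst /mmap mulr_sumr; apply: eq_big_seq => m ma.
rewrite mulrCA; congr (_ * _); rewrite /mmap1.
under eq_bigr => i _ do rewrite exprMn.
by rewrite big_split prodrXr -mdegE; congr (_ ^+ _ * _); apply: ha.
Qed.

End Substitution.

Lemma subst_id (F : fieldType) (N : nat) (a : {mpoly F[N]}) : subst (fun i => 'X_i) a = a.
Proof.
elim/(@mpoly_ring_ind F N): a => [c|i|a b Ea Eb|a b Ea Eb]; rewrite ?substC ?substX //.
  by rewrite rmorphD /= Ea Eb.
by rewrite rmorphM /= Ea Eb.
Qed.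

(** * From the ideal of fixed points to the regular eigenscheme *)

Section Homogenization.
Context {R : realType} {n : nat}.
Local Notation A := {mpoly R[i][n.+1]}.
Implicit Types (f g a h : A).

(** This is q^e times [a] evaluated at (x/q) X, with components of degree above [e] dropped; for
    large [e] it is that substitution with denominators cleared. *)
Local Definition rehomog (q x : A) (e : nat) (a : A) : A :=
  \sum_(k < e.+1) q ^+ (e - k) * x ^+ k * hc k a.

Lemma rehomogD q x e a b : rehomog q x e (a + b) = rehomog q x e a + rehomog q x e b.
Proof.
by rewrite /rehomog -big_split; apply: eq_bigr => k _; rewrite linearD mulrDr.
Qed.

Lemma rehomog_sum q x e (T : Type) (r : seq T) (p : pred T) (F : T -> A) :
  rehomog q x e (\sum_(i <- r | p i) F i) = \sum_(i <- r | p i) rehomog q x e (F i).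
Proof.
apply: (big_morph _ (rehomogD q x e)).
by rewrite /rehomog big1 // => k _; rewrite linear0 mulr0.
Qed.

Lemma rehomog_homog q x e d a : a \is d.-homog -> (d <= e)%N ->
  rehomog q x e a = q ^+ (e - d) * x ^+ d * a.
Proof.
move=> ha; rewrite -ltnS => lede; rewrite /rehomog (bigD1 (Ordinal lede)) //=.
rewrite pihomog_dE // big1 ?addr0 // => k ne.
rewrite (pihomog_ne0 _ ha) ?mulr0 //; apply: contraNneq ne => E.
by apply/eqP/val_inj.
Qed.

Variable f : A.
Hypothesis hf : f \is 3.-homog.
Local Notation E := (eigen_ideal f).

Lemma eigen_ideal_ideal : is_ideal E. Proof. exact: ideal_gen_ideal. Qed.
Local Notation idE := eigen_ideal_ideal.

Lemma eigen_minor i j : E ('X_i * f^`M(j) - 'X_j * f^`M(i)).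
Proof.
exact: (ideal_gen_mem (fun ij : 'I_n.+1 * 'I_n.+1 =>
  'X_(ij.1) * f^`M(ij.2) - 'X_(ij.2) * f^`M(ij.1)) (i, j)).
Qed.

(* Where f^`M(j) is invertible, x = (X_j / f^`M(j)) q modulo the minors, so that
   homogenizing with weights X_j and f^`M(j) kills the ideal of fixed points. *)
Lemma rehomog_fix j g : fix_ideal f g ->
  exists e0, forall e, (e0 <= e)%N -> E (rehomog f^`M(j) 'X_j e g).
Proof.
(* The 2 leaves room for multiplying the components of [h i] by the quadric q_i. *)
move=> [h gE]; exists (\max_(i < n.+1) msize (h i)).+2%N => e0 le0.
pose e := (e0 - 2)%N; have e0E : e0 = e.+2 by rewrite /e; lia.
rewrite gE rehomog_sum; apply: (ideal_sum _ idE) => i _.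
have hsize : (msize (h i) <= e.+1)%N.
  have := @leq_bigmax _ (fun i => msize (h i)) i; move: le0; rewrite /e.
  move: (\max_(_ < _) _)%N => m; lia.
rewrite (@pihomog_partitionE _ _ mdeg _ _ hsize) mulr_suml rehomog_sum.
apply: (ideal_sum _ idE) => k _; rewrite e0E mulrBr rehomogD -mulrN.
have hk := pihomogP mdeg k (h i).
have hNX : (- 'X_i : A) \is 1.-homog by rewrite rpredN X_homog.
rewrite (rehomog_homog _ _ (dhomogM hk (dhomog_mderiv i hf))); last first.
  by have := ltn_ord k; lia.
rewrite (rehomog_homog _ _ (dhomogM hk hNX)); last by have := ltn_ord k; lia.
have -> : (e.+2 - (k + 1) = (e.+2 - (k + 2)).+1)%N by have := ltn_ord k; lia.
rewrite addn1 addn2 !exprS; set y := _ ^+ (e.+2 - _); set z := _ ^+ k.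
rewrite (_ : _ + _ = - (y * 'X_j * z * hc k (h i)) *
  ('X_i * f^`M(j) - 'X_j * f^`M(i))); last by ring.
by apply: (idealMl _ idE); apply: eigen_minor.
Qed.

(** The quadric q_j takes the value q_j^3 at q_j x. Modulo the minors q_j x equals x_j q, where q_j
    takes the value x_j^2 q_j(q). *)
Lemma grad_cube j : exists r, E (f^`M(j) ^+ 3 - 'X_j ^+ 2 * r).
Proof.
set q := f^`M(j); have hq : q \is 2.-homog by apply: dhomog_mderiv.
exists (subst (fun i => f^`M(i)) q).
have -> : q ^+ 3 = subst (fun i => q * 'X_i) q.
  by rewrite (subst_homogM _ _ hq) subst_id -exprSr.
rewrite -(subst_homogM _ _ hq); apply: (subst_congr _ idE) => i.
by rewrite mulrC; apply: eigen_minor.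
Qed.

(** [rehomog_fix] puts q_j^(e-d) x_j^d g among the combinations of minors. The factor x_j^d is then
    traded for q_j^(3d), a multiple of x_j^(2d) modulo the minors by [grad_cube]. *)
Lemma fix_ideal_homog_eigen d g j : g \is d.-homog -> fix_ideal f g ->
  exists k, E (f^`M(j) ^+ k * g).
Proof.
move=> hg Ig; have [e0 He] := rehomog_fix j Ig; have [r Er] := grad_cube j.
pose e := (e0 + d)%N; have := He e (leq_addr _ _).
rewrite (rehomog_homog _ _ hg) ?leq_addl // => Ee.
exists (3 * d + (e - d))%N; rewrite exprD exprM.
rewrite (_ : _ * _ = ((f^`M(j) ^+ 3) ^+ d - ('X_j ^+ 2 * r) ^+ d) * (f^`M(j) ^+ (e - d) * g)
   + 'X_j ^+ d * r ^+ d * (f^`M(j) ^+ (e - d) * 'X_j ^+ d * g)); last first.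
  have -> : ('X_j ^+ 2 * r) ^+ d = 'X_j ^+ d * 'X_j ^+ d * r ^+ d :> A.
    by rewrite exprMn expr2 exprMn.
  by ring.
apply: (idealD idE); last exact: (idealMl _ idE).
by apply: (idealMr _ idE); apply: (ideal_congrX _ idE).
Qed.

(** Passes from powers of single derivatives to the products in the saturation: the first factor is
    expanded in the q_j, and absorbing q_j into [g] lowers [e j]. If [e j] is already 0, then [g]
    itself lies in the ideal. *)
Lemma eigen_ideal_grad_prod k (e : 'I_n.+1 -> nat) g : (\sum_j e j = k)%N ->
  (forall j, E (f^`M(j) ^+ e j * g)) ->
  forall s : 'I_k -> A, (forall i, irr_ideal f (s i)) -> E (g * \prod_i s i).
Proof.
elim: k e g => [|k IHk] e g sume Eg s irr.
  have /eqP := sume; rewrite sum_nat_eq0 => /forallP/(_ ord0)/eqP e0.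
  by have := Eg ord0; rewrite e0 mul1r; apply: (idealMr _ idE).
rewrite big_ord_recl; have [h ->] := irr ord0.
rewrite mulr_suml mulr_sumr; apply: (ideal_sum _ idE) => j _.
rewrite -!mulrA mulrCA; apply: (idealMl _ idE); rewrite mulrA [g * _]mulrC.
case ej : (e j) => [|ej'].
  by have := Eg j; rewrite ej mul1r => Eg'; rewrite mulrAC; apply: (idealMl _ idE).
apply: (IHk (fun l => if l == j then ej' else e l)) => [|l|i]; last exact: irr.
  rewrite (bigD1 j) //= eqxx; have := sume; rewrite (bigD1 j) //= ej.
  by rewrite addSn => -[<-]; congr addn; apply: eq_bigr => l /negPf ->.
case: eqVneq => [->|_]; first by have := Eg j; rewrite ej exprSr mulrA.
by rewrite mulrCA; apply: (idealMl _ idE).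
Qed.

Lemma reg_ideal_of_fix d g : g \is d.-homog -> fix_ideal f g -> reg_ideal f g.
Proof.
move=> hg Ig; have /choice[e Ee] := fun j => fix_ideal_homog_eigen j hg Ig.
by exists (\sum_j e j)%N; apply: (eigen_ideal_grad_prod _ Ee).
Qed.

End Homogenization.

(** * Reduced regular eigenschemes *)

Definition fixed_point (F : fieldType) (N : nat) (f : {mpoly F[N]}) (v : 'rV[F]_N) : Prop :=
  forall i, (f^`M(i)).@[fun j => v 0 j] = v 0 i.

(* [good f u]: the fixed-point scheme of the gradient of f in affine space is
   reduced and consists of u real points, the origin included. Reducedness is
   encoded by a squarefree split equation for each coordinate. *)
Definition good (R : realType) (N : nat) (f : {mpoly R[i][N]}) (u : nat) : Prop :=
  [/\ f \is 3.-homog,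
      forall i, exists cs : seq R[i], [/\ uniq cs, {in cs, forall c, c \is Num.real}
        & fix_ideal f (\prod_(c <- cs) ('X_i - c%:MP))]
    & exists L : seq 'rV[R[i]]_N, [/\ uniq L, size L = u
        & forall v, v \in L <-> fixed_point f v]].

Section FixedPoints.
Context {F : fieldType} {N : nat}.
Implicit Types (f : {mpoly F[N]}) (v : 'rV[F]_N).

Lemma fix_ideal_gen f i : fix_ideal f (f^`M(i) - 'X_i).
Proof. exact: (ideal_gen_mem (fun i => f^`M(i) - 'X_i)). Qed.

Lemma fix_ideal_ideal f : is_ideal (fix_ideal f).
Proof. exact: ideal_gen_ideal. Qed.

Lemma fixed_pointP f v :
  fixed_point f v <-> forall a, fix_ideal f a -> a.@[fun i => v 0 i] = 0.
Proof.
split=> [fv _ [h ->]|fv i].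
  rewrite rmorph_sum /= big1 // => i _.
  by rewrite mevalM mevalB mevalXU fv subrr mulr0.
apply/eqP; rewrite -subr_eq0; apply/eqP.
by have := fv _ (fix_ideal_gen f i); rewrite mevalB mevalXU.
Qed.

End FixedPoints.

(** * The points of the regular eigenscheme *)

Section RegularPoints.
Context {R : realType} {n : nat}.
Local Notation C := R[i].
Local Notation A := {mpoly C[n.+1]}.
Implicit Types (f g a b : A) (v w : 'rV[C]_n.+1) (P : set A).

Definition vanishing v : set A := [set a | a.@[fun i => v 0 i] = 0].

Lemma vanishing_prime v : is_prime (vanishing v).
Proof.
split; first split; rewrite /vanishing /=.
- by rewrite meval0.
- by move=> a b /= Ea Eb; rewrite mevalD Ea Eb addr0.
- by move=> a b /= Eb; rewrite mevalM Eb mulr0.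
- by rewrite meval1; apply/eqP/oner_neq0.
- by move=> a b /=; rewrite mevalM => /eqP; rewrite mulf_eq0 => /orP[/eqP|/eqP]; [left|right].
Qed.

(** For nonzero [v], the homogeneous ideal of the projective point spanned by [v]. *)
Definition line_ideal v : set A := hcore (vanishing v).

Lemma line_ideal_prime v : is_prime (line_ideal v).
Proof. exact/hcore_prime/vanishing_prime. Qed.

Lemma line_ideal_homog v d a : a \is d.-homog -> a.@[fun i => v 0 i] = 0 -> line_ideal v a.
Proof.
by move=> ha av; apply: hcore_homog ha av; case: (vanishing_prime v).
Qed.

Lemma line_ideal_eval v a : line_ideal v a -> a.@[fun i => v 0 i] = 0.
Proof. by apply: homog_ideal_elt; case: (vanishing_prime v). Qed.

Lemma poly_eq0_of_values (K : numFieldType) (p : {poly K}) : (forall x, p.[x] = 0) -> p = 0.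
Proof.
move=> p0; apply: contraTeq isT => pn0.
pose rs : seq K := [seq i%:R | i <- iota 0 (size p)].
have := max_poly_roots (rs := rs) pn0; rewrite size_map size_iota ltnn; apply.
  by apply/allP => x _; rewrite rootE p0.
by rewrite map_inj_uniq ?iota_uniq // => i j /eqP; rewrite eqr_nat => /eqP.
Qed.

(** Along the line, [a] is a polynomial in the scalar whose coefficients are the values at [v] of
    its components; vanishing at every scalar kills them all. *)
Lemma point_idealE (p : ppoint R n) v : val p = <[v]>%VS -> point_ideal p = line_ideal v.
Proof.
move=> pv; apply/seteqP; split=> a; last first.
  move=> la w; rewrite pv => /vlineP[x ->].
  have [k ->] := homog_split a; rewrite rmorph_sum /= big1 // => d _.
  by rewrite (meval_homogZ _ _ (pihomogP mdeg d a)) (la d : _ = 0) mulr0.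
move=> la d; rewrite /vanishing /=.
pose p' := \poly_(e < msize a) (hc e a).@[fun i => v 0 i].
have p'0 : p' = 0.
  apply: poly_eq0_of_values => x; have := la (x *: v).
  rewrite pv memvZ ?memv_line // => /(_ isT) <-.
  rewrite [in RHS](@pihomog_partitionE _ _ mdeg _ a (leqnn _)) rmorph_sum horner_poly /=.
  by apply: eq_bigr => e _; rewrite (meval_homogZ _ _ (pihomogP mdeg e a)) mulrC.
have := coef_poly (msize a) (fun e => (hc e a).@[fun i => v 0 i]) d.
rewrite -/p' p'0 coef0; case: ltnP => [_ <- //|ge _].
rewrite pihomogE big_seq_cond big_pred0 ?meval0 // => m.
by apply/negP => /andP[/msize_mdeg_lt + /eqP E]; rewrite E ltnNge ge.
Qed.

Lemma line_ideal_minor v i j : line_ideal v (v 0 i *: 'X_j - v 0 j *: 'X_i).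
Proof.
apply: (@line_ideal_homog _ 1); first by apply: rpredB; apply: rpredZ; apply: X_homog.
by rewrite mevalB !mevalZ !mevalXU mulrC subrr.
Qed.

(** A larger [P] contains a form with nonzero value at [v]. Modulo the line ideal this form is
    proportional to a power of ['X_i], so [P] contains ['X_i], and by the linear minors every
    variable. *)
Lemma line_ideal_max v P : is_prime P -> homog_ideal P -> (exists i, ~ P 'X_i) ->
  v != 0 -> line_ideal v `<=` P -> P = line_ideal v.
Proof.
move=> prP hP [k nPk] /rV0Pn[i vi] lP; apply/seteqP; split=> // a Pa d /=.
have [idP _ _] := prP; apply: contrapT => /eqP c0; apply: nPk.
set c := (X in X != 0) in c0.
have : line_ideal v (v 0 i ^+ d *: hc d a - c *: 'X_i ^+ d).
  apply: (@line_ideal_homog _ d).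
    apply: rpredB; apply: rpredZ; first exact: pihomogP.
    by have := @dhomogMn _ _ mdeg 1 _ d (@X_homog R n i); rewrite mul1n.
  by rewrite mevalB !mevalZ rmorphXn /= mevalXU mulrC subrr.
move/lP => Pd; have : P (c *: 'X_i ^+ d).
  rewrite -(subrK (c *: 'X_i ^+ d) (v 0 i ^+ d *: hc d a)) in Pd.
  apply: (ideal_congr (b := v 0 i ^+ d *: hc d a)) => //.
    by rewrite -opprB; apply: idealN => //; rewrite addrK in Pd.
  by rewrite -mul_mpolyC; apply: idealMl => //; apply: hP.
move/(idealMl c^-1%:MP idP); rewrite mul_mpolyC scalerA mulVf // scale1r.
move/(prime_exp prP) => Pi.
have : P (v 0 i *: 'X_k).
  apply: (ideal_congr (b := v 0 k *: 'X_i)) => //; first exact/lP/line_ideal_minor.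
  by rewrite -mul_mpolyC; apply: idealMl.
move/(idealMl (v 0 i)^-1%:MP idP).
by rewrite mul_mpolyC scalerA mulVf // scale1r.
Qed.

(** The form is a product with one factor outside [P] for each listed point, vanishing there. *)
Lemma separating_form P (s : seq 'rV[C]_n.+1) : is_prime P -> homog_ideal P ->
  (forall v, v \in s -> ~ line_ideal v `<=` P) ->
  exists d b, [/\ b \is d.-homog, ~ P b & forall v, v \in s -> b.@[fun i => v 0 i] = 0].
Proof.
move=> prP hP; have [idP P1 pr] := prP; elim: s => [|v s IHs] sP.
  by exists 0%N, 1; split=> //; apply: dhomog1.
have [|d [b [hb nPb bs]]] := IHs; first by move=> w ws; apply: sP; rewrite inE ws orbT.
have [e [a [ha nPa av]]] : exists e a, [/\ a \is e.-homog, ~ P a & a.@[fun i => v 0 i] = 0].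
  apply: contrapT => noa; apply: (sP v (mem_head _ _)) => a la.
  apply: (homog_ideal_elt idP) => e; apply: contrapT => nPe; apply: noa.
  by exists e, (hc e a); split=> //; [exact: pihomogP | exact: la].
exists (e + d)%N, (a * b); split; first exact: dhomogM.
  by move/pr => [].
by move=> w; rewrite inE mevalM => /predU1P[->|/bs ->]; rewrite ?av ?mul0r ?mulr0.
Qed.

Section Good.
Variables (f : A) (t : nat).
Hypothesis hgood : good f t.+1.

Let hf : f \is 3.-homog. Proof. by case: hgood. Qed.

Lemma fixed_point_grad v : fixed_point f v <-> grad_at f v = v.
Proof.
split=> [fv|gv i]; first by apply/rowP => i; rewrite mxE fv.
by have := congr1 (fun u : 'rV_ _ => u 0 i) gv; rewrite mxE.
Qed.

Lemma fixed_point0 : fixed_point f 0.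
Proof.
apply/fixed_point_grad; rewrite -[in LHS](scale0r 0) (grad_homogZ _ _ hf).
by rewrite expr0n /= scale0r.
Qed.

(** The gradient sends x v to x^2 v, so x is 0 or 1: a line carries at most one nonzero fixed
    point. *)
Lemma fixed_point_line v x : v != 0 -> fixed_point f v -> fixed_point f (x *: v) ->
  x *: v != 0 -> x *: v = v.
Proof.
move=> v0 /fixed_point_grad gv /fixed_point_grad; rewrite (grad_homogZ _ _ hf) gv.
move=> /eqP; rewrite -subr_eq0 -scalerBl scaler_eq0 (negPf v0) orbF expr2.
rewrite -{3}[x]mulr1 -mulrBr mulf_eq0 subr_eq0 => /orP[/eqP->|/eqP-> _].
  by rewrite scale0r eqxx.
by rewrite scale1r.
Qed.

Lemma good_zeros : exists L : seq 'rV[C]_n.+1, [/\ uniq L, size L = t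
  & forall v, v \in L <-> fixed_point f v /\ v != 0].
Proof.
have [_ _ [L [uL sL LP]]] := hgood; have L0 : 0 \in L by apply/LP/fixed_point0.
exists (rem 0 L); split; first exact: rem_uniq.
  by rewrite size_rem // sL.
move=> v; rewrite mem_rem_uniq // inE; split=> [/andP[v0 /LP]|[/LP vL v0]] //.
exact/andP.
Qed.

Lemma fixed_point_real v i : fixed_point f v -> v 0 i \is Num.real.
Proof.
move/fixed_pointP => fv; have [_ splitf _] := hgood.
have [cs [_ csR /fv]] := splitf i; rewrite rmorph_prod /= => /eqP; rewrite prodf_seq_eq0 => /hasP[c ccs /=].
by rewrite mevalB mevalXU mevalC subr_eq0 => /eqP ->; apply: csR.
Qed.

Lemma reg_ideal_vanish d g : g \is d.-homog ->
  (forall v, fixed_point f v -> g.@[fun i => v 0 i] = 0) -> reg_ideal f g.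
Proof.
move=> hg gv; apply: (reg_ideal_of_fix hf hg).
apply: radical_of_split; first exact: fix_ideal_ideal.
  by move=> i; have [_ /(_ i)[cs [ucs _ Ics]] _] := hgood; exists cs.
by move=> v /fixed_pointP; apply: gv.
Qed.

Lemma proj_pt_line v : v != 0 -> fixed_point f v -> proj_pt (reg_ideal f) (line_ideal v).
Proof.
move=> v0 fv; have [idV _ _] := vanishing_prime v; apply/proj_ptP.
have [i vi] : exists i, v 0 i != 0 by apply/rV0Pn.
split.
- exact: line_ideal_prime.
- by move=> a d; apply: hcore_hc.
- apply: (@reg_ideal_sub _ _ _ _ i (line_ideal_prime v)).
    apply: (eigen_ideal_hcore hf idV) => a Ia.
    by have /fixed_pointP := fv; apply.
  by move/line_ideal_eval; rewrite fv; apply/eqP.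
- by exists i => /line_ideal_eval; rewrite mevalXU; apply/eqP.
Qed.

(** The extra factor ['X_k], outside [P], makes the form vanish at the origin too, as
    [reg_ideal_vanish] requires. *)
Lemma reg_ideal_form P (s : seq 'rV[C]_n.+1) : proj_pt (reg_ideal f) P ->
  (forall v, v \in s -> ~ line_ideal v `<=` P) ->
  exists d b, [/\ b \is d.-homog, ~ P b & forall v, v \in 0 :: s -> b.@[fun i => v 0 i] = 0].
Proof.
move=> /proj_ptP[prP hP _ [k nPk]] sP; have [_ _ pr] := prP.
have [d [b [hb nPb bs]]] := separating_form prP hP sP.
exists (1 + d)%N, ('X_k * b); split; first by apply: dhomogM hb; apply: X_homog.
  by move/pr => [].
move=> v; rewrite inE mevalM mevalXU => /predU1P[->|/bs ->]; last by rewrite mulr0.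
by rewrite mxE mul0r.
Qed.

(** If [P] contained no line ideal of a nonzero fixed point, some form outside [P] would vanish at
    all fixed points, hence lie in [reg_ideal f] and so in [P]. *)
Lemma proj_pt_is_line P : proj_pt (reg_ideal f) P ->
  exists v, [/\ v != 0, fixed_point f v & P = line_ideal v].
Proof.
move=> PP; have [prP hP regP nP] := (proj_ptP _ _).1 PP.
have [L [_ _ LP]] := good_zeros.
have [v vL lP] : exists2 v, v \in L & line_ideal v `<=` P.
  apply: contrapT => noL; have [|d [b [hb nPb bs]]] := @reg_ideal_form P L PP.
    by move=> v vL lP; apply: noL; exists v.
  apply/nPb/regP; apply: (reg_ideal_vanish hb) => v fv; apply: bs.
  have [->|v0] := eqVneq v 0; first exact: mem_head.
  by rewrite inE; apply/orP; right; apply/LP.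
have [fv v0] := (LP v).1 vL; exists v; split=> //.
exact: line_ideal_max.
Qed.

(** The denominator is a form [b] outside [P] vanishing at every fixed point but [v]; since [a]
    vanishes at [v], the product vanishes at all fixed points and lies in [reg_ideal f]. *)
Lemma good_reduced : proj_reduced (reg_ideal f).
Proof.
move=> P d a s PP ha _ _ k [e [u [hu nPu regu]]].
have [v [v0 fv PE]] := proj_pt_is_line PP.
have [prP hP regP nP] := (proj_ptP _ _).1 PP; have [_ _ pr] := prP.
have Pa : P a by case: (pr _ _ (regP _ regu)) => // /(prime_exp prP).
have [L [uL _ LP]] := good_zeros.
have [|e' [b [hb nPb bs]]] := @reg_ideal_form P (rem v L) PP.
  move=> w; rewrite mem_rem_uniq // inE => /andP[wv /LP[fw w0]].
  rewrite PE => lwv; case/rV0Pn: (w0) => i wi.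
  have vE : v = (v 0 i / w 0 i) *: w.
    apply/rowP => j; rewrite mxE mulrAC.
    have /lwv/line_ideal_eval := line_ideal_minor w i j.
    rewrite mevalB !mevalZ !mevalXU => /eqP; rewrite subr_eq0 => /eqP E.
    by rewrite [v 0 i * _]mulrC -E mulrAC mulfV // mul1r.
  have := @fixed_point_line w (v 0 i / w 0 i) w0 fw; rewrite -vE => /(_ fv v0) E.
  by rewrite E eqxx in wv.
exists e', b; split; [exact: hb | exact: nPb |].
apply: (reg_ideal_vanish (dhomogM hb ha)) => w fw.
rewrite mevalM; have [->|wv] := eqVneq w v.
  by move: Pa; rewrite PE => /line_ideal_eval ->; rewrite mulr0.
rewrite bs ?mul0r // inE; have [//|w0 /=] := eqVneq w 0.
by rewrite mem_rem_uniq // inE wv; apply/LP.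
Qed.

Lemma good_points : consists_of_real_points (reg_ideal f) t.
Proof.
have [L [uL sL LP]] := good_zeros.
pose T := {U : {vspace 'rV[C]_n.+1} | \dim U == 1%N}.
pose s : seq T := pmap insub [seq <[v]>%VS | v <- L].
have sP (p : ppoint R n) : p \in (s : seq T) <-> exists2 v, v \in L & val p = <[v]>%VS.
  rewrite mem_pmap_sub; split=> [/mapP[v vL E]|[v vL ->]]; first by exists v.
  exact: map_f.
exists [set p | p \in (s : seq T)]; split.
- have us : uniq s.
    apply: pmap_sub_uniq; rewrite map_inj_in_uniq // => v w vL wL E.
    have [fv v0] := (LP v).1 vL; have [fw w0] := (LP w).1 wL.
    have /vlineP[x vE] : v \in <[w]>%VS by rewrite -E memv_line.
    rewrite vE; apply: fixed_point_line => //; rewrite -?vE //.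
  have <- : #|` [fset p in s]%fset| = t.
    rewrite card_fseq undup_id // size_pmap_sub count_map -sL; apply/eqP.
    rewrite -all_count; apply/allP => v /LP[_ v0] /=.
    by rewrite dim_vline v0.
  rewrite (_ : [set p | p \in s] = [set` [fset p in s]%fset]); first exact/card_eq_fsetP.
  by apply/seteqP; split=> p /=; rewrite !inE.
- move=> p /sP[v /LP[fv _] pv]; exists v => // i; exact: fixed_point_real.
- apply/seteqP; split=> [P /proj_pt_is_line[v [v0 fv ->]]|_ [p /sP[v /LP[fv v0] pv] <-]].
    have dv : \dim <[v]> == 1%N by rewrite dim_vline v0.
    exists (Sub <[v]>%VS dv : T); last by apply: point_idealE; rewrite SubK.
    apply/sP; rewrite SubK.
    by exists v => //; apply/LP.
  by rewrite (point_idealE pv); apply: proj_pt_line.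
Qed.

End Good.
End RegularPoints.

(** * Direct sums of cubics *)

Section Renaming.
Context {F : fieldType} {N K : nat} (h : 'I_N -> 'I_K).
Hypothesis h_inj : injective h.
Implicit Types a : {mpoly F[N]}.

Definition rename : {mpoly F[N]} -> {mpoly F[K]} := subst (fun i => 'X_(h i)).

HB.instance Definition _ := GRing.RMorphism.on rename.

Lemma renameX i : rename 'X_i = 'X_(h i).
Proof. exact: substX. Qed.

Lemma renameC c : rename c%:MP = c%:MP.
Proof. exact: substC. Qed.

Lemma rename_homog d a : a \is d.-homog -> rename a \is d.-homog.
Proof.
move/dhomogP => ha; rewrite /rename /subst /mmap big_seq; apply: rpred_sum => m ma.
rewrite mul_mpolyC; apply: rpredZ; rewrite /mmap1 mprodXnE dhomogX /= mdeg_sum.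
under eq_bigr => i _ do rewrite mdegMn mdeg1 mul1n.
by rewrite -mdegE; apply/eqP/ha.
Qed.

Lemma meval_rename v a : (rename a).@[v] = a.@[v \o h].
Proof.
elim/(@mpoly_ring_ind F N): a => [c|i|a b Ea Eb|a b Ea Eb].
- by rewrite renameC !mevalC.
- by rewrite renameX !mevalXU.
- by rewrite rmorphD /= !mevalD Ea Eb.
- by rewrite rmorphM /= !mevalM Ea Eb.
Qed.

Lemma mderivXU (n : nat) (i j : 'I_n) : ('X_j : {mpoly F[n]})^`M(i) = (i == j)%:R.
Proof.
rewrite mderivX mnm1E eq_sym; case: eqVneq => [->|_]; last by rewrite scale0r.
by rewrite scale1r -mpolyX0; congr 'X_[_]; apply/mnmP => k; rewrite mnmBE mnm0E subnn.
Qed.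

Lemma mderiv_rename i a : (rename a)^`M(h i) = rename a^`M(i).
Proof.
elim/(@mpoly_ring_ind F N): a => [c|j|a b Ea Eb|a b Ea Eb].
- by rewrite renameC !mderivC rmorph0.
- by rewrite renameX !mderivXU (inj_eq h_inj) rmorph_nat.
- by rewrite rmorphD /= !mderivD Ea Eb rmorphD.
- by rewrite rmorphM /= !mderivM Ea Eb rmorphD !rmorphM.
Qed.

Lemma mderiv_rename0 k a : (forall i, h i != k) -> (rename a)^`M(k) = 0.
Proof.
move=> hk; elim/(@mpoly_ring_ind F N): a => [c|j|a b Ea Eb|a b Ea Eb].
- by rewrite renameC mderivC.
- by rewrite renameX mderivXU eq_sym (negPf (hk j)).
- by rewrite rmorphD mderivD Ea Eb addr0.
- by rewrite rmorphM mderivM Ea Eb mul0r mulr0 addr0.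
Qed.

End Renaming.

Section DirectSum.
Context {R : realType} {N M : nat}.
Implicit Types (f : {mpoly R[i][N]}) (g : {mpoly R[i][M]}).

Definition mpoly_oplus f g : {mpoly R[i][N + M]} :=
  rename (@lshift N M) f + rename (@rshift N M) g.

Lemma mderiv_oplusl f g i : (mpoly_oplus f g)^`M(lshift M i) = rename (@lshift N M) f^`M(i).
Proof.
rewrite mderivD mderiv_rename; last exact: lshift_inj.
by rewrite mderiv_rename0 ?addr0 // => j; rewrite eq_rlshift.
Qed.

Lemma mderiv_oplusr f g j : (mpoly_oplus f g)^`M(rshift N j) = rename (@rshift N M) g^`M(j).
Proof.
rewrite mderivD [X in _ + X]mderiv_rename; last exact: rshift_inj.
by rewrite mderiv_rename0 ?add0r // => i; rewrite eq_lrshift.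
Qed.

Lemma fix_ideal_oplusl f g a :
  fix_ideal f a -> fix_ideal (mpoly_oplus f g) (rename (@lshift N M) a).
Proof.
move=> [x ->]; rewrite rmorph_sum /=; apply: (ideal_sum _ (fix_ideal_ideal _)) => i _.
rewrite rmorphM; apply: (idealMl _ (fix_ideal_ideal _)).
by rewrite rmorphB /= renameX -(mderiv_oplusl f g); apply: fix_ideal_gen.
Qed.

Lemma fix_ideal_oplusr f g a :
  fix_ideal g a -> fix_ideal (mpoly_oplus f g) (rename (@rshift N M) a).
Proof.
move=> [x ->]; rewrite rmorph_sum /=; apply: (ideal_sum _ (fix_ideal_ideal _)) => i _.
rewrite rmorphM; apply: (idealMl _ (fix_ideal_ideal _)).
by rewrite rmorphB /= renameX -(mderiv_oplusr f g); apply: fix_ideal_gen.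
Qed.

Lemma fixed_point_oplus f g v : fixed_point (mpoly_oplus f g) v <->
  fixed_point f (lsubmx v) /\ fixed_point g (rsubmx v).
Proof.
have El i : ((mpoly_oplus f g)^`M(lshift M i)).@[fun j => v 0 j]
    = (f^`M(i)).@[fun j => lsubmx v 0 j].
  by rewrite mderiv_oplusl meval_rename; apply: meval_eq => j; rewrite /= mxE.
have Er i : ((mpoly_oplus f g)^`M(rshift N i)).@[fun j => v 0 j]
    = (g^`M(i)).@[fun j => rsubmx v 0 j].
  by rewrite mderiv_oplusr meval_rename; apply: meval_eq => j; rewrite /= mxE.
split=> [fv|[fl fr] i].
  by split=> i; rewrite -?El -?Er fv mxE.
by case: (split_ordP i) => j ->; [rewrite El fl | rewrite Er fr]; rewrite mxE.
Qed.

(** In separate variables the gradient acts blockwise: fixed points are pairs, and each coordinate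
    keeps its split equation. *)
Lemma good_oplus f g u w : good f u -> good g w -> good (mpoly_oplus f g) (u * w).
Proof.
move=> [hf splitf [L1 [u1 s1 P1]]] [hg splitg [L2 [u2 s2 P2]]]; split.
- by apply: rpredD; apply: rename_homog.
- move=> i; case: (split_ordP i) => j ->.
    have [cs [ucs rcs Ics]] := splitf j; exists cs; split=> //.
    have := fix_ideal_oplusl g Ics; rewrite rmorph_prod /=.
    by under eq_bigr => c _ do rewrite rmorphB /= renameX renameC.
  have [cs [ucs rcs Ics]] := splitg j; exists cs; split=> //.
  have := fix_ideal_oplusr f Ics; rewrite rmorph_prod /=.
  by under eq_bigr => c _ do rewrite rmorphB /= renameX renameC.
- exists [seq row_mx x y | x <- L1, y <- L2]; split.
  + by apply: allpairs_uniq => // -[x y] [x' y'] _ _ /= /eq_row_mx[-> ->].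
  + by rewrite size_allpairs s1 s2.
  move=> v; rewrite fixed_point_oplus; split.
    by move=> /allpairsP[[x y] /= [/P1 fx /P2 fy ->]]; rewrite row_mxKl row_mxKr.
  by move=> [/P1 fl /P2 fr]; rewrite -(hsubmxK v); apply: allpairs_f.
Qed.

End DirectSum.

(** * Systems with rational zeros *)

Definition grid (T : Type) (rss : seq (seq T)) : seq (seq T) :=
  foldr (fun rs ss => [seq r :: s | r <- rs, s <- ss]) [:: [::]] rss.

Lemma gridP (T : eqType) (x0 : T) (rss : seq (seq T)) (s : seq T) :
  reflect (size s = size rss /\ forall i, (i < size rss)%N -> nth x0 s i \in nth [::] rss i)
          (s \in grid rss).
Proof.
elim: rss s => [|rs rss IHrss] s /=.
  rewrite inE; apply: (iffP eqP) => [->|[/size0nil]] //.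
apply: (iffP allpairsP) => [[[r s'] /= [rrs /IHrss[ss sP] ->]]|[]].
  by split=> [|[|i] ltis] //=; [rewrite ss | apply: sP].
case: s => //= r s [ss] sP; exists (r, s) => /=; split=> //; first exact: (sP 0%N).
by apply/IHrss; split=> // i ltis; apply: (sP i.+1).
Qed.

Lemma grid_uniq (T : eqType) (rss : seq (seq T)) : all uniq rss -> uniq (grid rss).
Proof.
elim: rss => //= rs rss IHrss /andP[urs /IHrss ug].
by apply: allpairs_uniq => // -[r s] [r' s'] _ _ /= [-> ->].
Qed.

(** Roots are stored as numerator and denominator, so that the factors q x - p make sense in every
    commutative ring. *)
Definition frac (pq : int * nat) : rat := pq.1%:~R / pq.2%:R.

Section GoodGrid.
Context {R : realType} {N : nat}.
Local Notation C := R[i].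
Implicit Types (f : {mpoly C[N]}).

Lemma ratr_real (r : rat) : (ratr r : C) \is Num.real.
Proof. by rewrite realE ler0q lerq0 -realE num_real. Qed.

(* The coordinates are rescaled by d to become rational on the zeros. *)
Lemma good_of_grid f (d : 'I_N -> C) (rss : seq (seq (int * nat))) (rel : seq rat -> bool) u :
  f \is 3.-homog -> size rss = N ->
  (forall i, d i \is Num.real) -> (forall i, d i != 0) ->
  all (all (fun pq => pq.2 != 0%N)) rss -> all uniq (map (map frac) rss) ->
  (forall i : 'I_N, fix_ideal f
     (\prod_(pq <- nth [::] rss i) (pq.2%:R * (d i *: 'X_i) - pq.1%:~R))) ->
  (forall s, size s = N -> fixed_point f (\row_i ((d i)^-1 * ratr (nth 0 s i))) <-> rel s) ->
  size (filter rel (grid (map (map frac) rss))) = u ->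
  good f u.
Proof.
move=> hf szr dR d0 q0 ur Ir relP szu.
have fracK (pq : int * nat) : pq.2 != 0%N ->
    (pq.2%:R * ratr (frac pq) : C) = pq.1%:~R.
  move=> q0'; rewrite fmorph_div /= ratr_int ratr_nat mulrCA mulfV ?mulr1 //.
  by rewrite pnatr_eq0.
have nz (i : 'I_N) pq : pq \in nth [::] rss i -> pq.2 != 0%N.
  by move/allP: q0 => /(_ (nth [::] rss i)); rewrite mem_nth ?szr // => /(_ isT)/allP; apply.
split=> // [i|].
  exists [seq (d i)^-1 * ratr r | r <- nth [::] (map (map frac) rss) i]; split.
  - rewrite map_inj_uniq; last by move=> x y /mulfI; rewrite invr_eq0 => /(_ (d0 i))/fmorph_inj.
    by move/allP: ur; apply; rewrite mem_nth // size_map szr.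
  - by move=> _ /mapP[r _ ->]; apply: realM; [rewrite realV | apply: ratr_real].
  rewrite (nth_map [::]) ?szr // !big_map.
  have idI := fix_ideal_ideal f.
  pose z := \prod_(pq <- nth [::] rss i) ((pq.2%:R * d i)^-1 : C).
  rewrite (_ : \prod_(_ <- _) _ = z%:MP *
    \prod_(pq <- nth [::] rss i) (pq.2%:R * (d i *: 'X_i) - pq.1%:~R)).
    exact: (idealMl _ idI).
  rewrite /z rmorph_prod -big_split /=; apply: eq_big_seq => pq /nz q0'.
  have qd0 : pq.2%:R * d i != 0 :> C by rewrite mulf_neq0 ?d0 ?pnatr_eq0.
  have -> : pq.1%:~R = (pq.2%:R * ratr (frac pq) : C)%:MP :> {mpoly C[N]}.
    by rewrite fracK // rmorph_int.
  have -> : pq.2%:R = (pq.2%:R : C)%:MP :> {mpoly C[N]} by rewrite mpolyC_nat.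
  move: (ratr (frac pq)) => r.
  rewrite -mul_mpolyC mulrA -!mpolyCM mulrBr mulrA -!mpolyCM mulVf // mul1r.
  congr (_ - _%:MP); rewrite mulrA invfM; congr (_ * _).
  by rewrite mulrAC mulVf ?mul1r // pnatr_eq0.
exists [seq \row_i ((d i)^-1 * ratr (nth 0 s i)) | s <- filter rel (grid (map (map frac) rss))].
split.
- rewrite map_inj_in_uniq ?filter_uniq ?grid_uniq // => s s'.
  rewrite !mem_filter => /andP[_ /(gridP 0)[ss _]] /andP[_ /(gridP 0)[ss' _]] E.
  apply: (@eq_from_nth _ 0); rewrite ?ss ?ss' ?size_map ?szr // => i ltiN.
  have := congr1 (fun v : 'rV_ _ => v 0 (Ordinal ltiN)) E.
  by rewrite !mxE => /mulfI; rewrite invr_eq0 d0 => /(_ isT)/fmorph_inj.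
- by rewrite size_map.
move=> v; split.
  case/mapP => s; rewrite mem_filter => /andP[rels /(gridP 0)[ss _]] ->.
  by apply/relP => //; rewrite ss size_map.
move=> fv.
(* Evaluating the split equations at [v] shows that [v] comes from a grid point. *)
have /fin_all_exists[r rP] : forall i : 'I_N, exists r : rat,
    r \in nth [::] (map (map frac) rss) i /\ v 0 i = (d i)^-1 * ratr r.
  move=> i; have := (fixed_pointP f v).1 fv _ (Ir i).
  rewrite rmorph_prod /= => /eqP; rewrite prodf_seq_eq0 => /hasP[pq pqi /=].
  have q0' := nz _ _ pqi.
  rewrite mevalB mevalM mevalZ mevalXU !rmorph_nat rmorph_int subr_eq0 => /eqP E.
  exists (frac pq); split; first by rewrite (nth_map [::]) ?szr // map_f.
  apply: (mulfI (d0 i)); rewrite mulrA mulfV // mul1r.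
  have q0C : (pq.2%:R : C) != 0 by rewrite pnatr_eq0.
  by apply: (mulfI q0C); rewrite E fracK.
pose s := [seq r i | i <- enum 'I_N].
have ss : size s = N by rewrite size_map size_enum_ord.
have sE (i : 'I_N) : nth 0 s i = r i.
  by rewrite (nth_map i) ?size_enum_ord // nth_ord_enum.
have vE : v = \row_i ((d i)^-1 * ratr (nth 0 s i)).
  by apply/rowP => i; rewrite mxE sE; case: (rP i).
rewrite vE; apply: map_f; rewrite mem_filter; apply/andP; split.
  by apply/(relP s ss); rewrite -vE.
apply/(gridP 0); split=> [|i]; rewrite ?ss [size (map _ rss)]size_map szr // => ltiN.
by have [] := rP (Ordinal ltiN); rewrite -sE.
Qed.

End GoodGrid.

Section GoodSystem.
Context {R : realType} {N : nat}.
Local Notation C := R[i].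
Local Notation A := {mpoly C[N]}.

(* After rescaling, the equations q_i(v) = v_i become a system E with integer
   coefficients, for which membership in the ideal and the enumeration of the
   zeros no longer depend on R. *)
Lemma good_of_system (f : A) (d : 'I_N -> C) (c : 'I_N -> C)
    (E : forall T : comNzRingType, (nat -> T) -> seq T)
    (rss : seq (seq (int * nat))) u :
  f \is 3.-homog -> size rss = N ->
  (forall i, d i \is Num.real) -> (forall i, d i != 0) -> (forall i, c i != 0) ->
  (forall (S T : comNzRingType) (g : {rmorphism S -> T}) x,
     E T (fun k => g (x k)) = map g (E S x)) ->
  (forall T x, size (E T x) = N) ->
  (forall x : nat -> A, (forall i : 'I_N, x i = (d i)%:MP * 'X_i) ->
     forall i : 'I_N, f^`M(i) - 'X_i = (c i)%:MP * nth 0 (E _ x) i) ->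
  (forall (T : comNzRingType) (I : set T) x, is_ideal I ->
     (forall k a, I (k.+1%:R * a) -> I a) ->
     (forall i, (i < N)%N -> I (nth 0 (E T x) i)) ->
     forall i, (i < N)%N -> I (\prod_(pq <- nth [::] rss i) (pq.2%:R * x i - pq.1%:~R))) ->
  all (all (fun pq => pq.2 != 0%N)) rss -> all uniq (map (map frac) rss) ->
  size (filter (fun s => all (pred1 0) (E rat (nth 0 s))) (grid (map (map frac) rss))) = u ->
  good f u.
Proof.
move=> hf szr dR d0 c0 Enat Esz Egrad Euni q0 ur szu.
(* [E] takes variables indexed by natural numbers; those from [N] on get the default 0. *)
pose x (k : nat) : A := if insub k is Some i then (d i)%:MP * 'X_i else 0.
have xE (i : 'I_N) : x i = (d i)%:MP * 'X_i by rewrite /x valK.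
apply: (good_of_grid (d := d) (rss := rss)
  (rel := fun s => all (pred1 0) (E rat (nth 0 s)))) => // [i|s ss].
  rewrite -mul_mpolyC -xE; apply: Euni => // [|k a Ia|k ltkN]; first exact: fix_ideal_ideal.
    have -> : a = ((k.+1%:R)^-1 : C)%:MP * (k.+1%:R * a).
      have -> : k.+1%:R = (k.+1%:R : C)%:MP :> A by rewrite mpolyC_nat.
      by rewrite mulrA -mpolyCM mulVf ?pnatr_eq0 // mpolyC1 mul1r.
    exact: (idealMl _ (fix_ideal_ideal f)).
  pose j := Ordinal ltkN; rewrite (_ : nth 0 _ k = (c j)^-1%:MP * (f^`M(j) - 'X_j)).
    exact: (idealMl _ (fix_ideal_ideal f) (fix_ideal_gen f j)).
  by rewrite (Egrad x xE) mulrA -mpolyCM mulVf // mpolyC1 mul1r.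
set v := \row_i _; have Ev (i : 'I_N) : ((f^`M(i)).@[fun j => v 0 j] == v 0 i) =
    (nth 0 (E rat (nth 0 s)) i == 0).
  rewrite -subr_eq0 -[v 0 i](mevalXU (fun j => v 0 j)) -mevalB (Egrad x xE) mevalM mevalC.
  rewrite mulf_eq0 (negPf (c0 i)) /=.
  have lt (T : comNzRingType) (y : nat -> T) : (i < size (E T y))%N by rewrite Esz.
  rewrite -[in RHS](fmorph_eq0 (ratr : {rmorphism rat -> C})) /=.
  rewrite -!(nth_map 0 0) ?lt //.
  (* Naturality along evaluation at [v] and along the embedding of the rationals reduces both sides
     to one system over the complex numbers. *)
  rewrite -(Enat _ _ (meval (fun j => v 0 j))) -(Enat _ _ (ratr : {rmorphism rat -> C})).
  congr (nth 0 (E _ _) i == 0); apply/funext => k.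
  have [ltk|gek] := ltnP k N.
    have -> : x k = _ := xE (Ordinal ltk).
    by rewrite /= mevalM mevalC mevalXU mxE mulrA mulfV // mul1r.
  by rewrite /x insubN -?leqNgt //= meval0 nth_default ?ss // rmorph0.
split=> [fv|/(all_nthP 0) Es i].
  by apply/(all_nthP 0) => k; rewrite Esz => ltk /=; rewrite -(Ev (Ordinal ltk)) fv.
by apply/eqP; rewrite Ev; apply: Es; rewrite Esz.
Qed.

End GoodSystem.

(** * Explicit cubics *)

Section Combinations.
Context {T : comNzRingType} (I : set T).
Hypothesis idI : is_ideal I.
Implicit Types x y z w p : T.

Lemma ideal_eq x p : I x -> p = x -> I p.
Proof. by move=> Ix ->. Qed.

Lemma ideal_comb2 x y p (a b : T) : I x -> I y -> p = a * x + b * y -> I p.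
Proof. by move=> Ix Iy ->; apply: idealD => //; apply: idealMl. Qed.

Lemma ideal_comb3 x y z p (a b c : T) :
  I x -> I y -> I z -> p = a * x + b * y + c * z -> I p.
Proof. by move=> Ix Iy Iz ->; apply: idealD; [|apply: ideal_comb2 (erefl _)|apply: idealMl]. Qed.

Lemma ideal_comb4 x y z w p (a b c d : T) :
  I x -> I y -> I z -> I w -> p = a * x + b * y + c * z + d * w -> I p.
Proof.
by move=> Ix Iy Iz Iw ->; apply: idealD; [|apply: ideal_comb3 (erefl _)|apply: idealMl].
Qed.

End Combinations.

Section Cubics.
Context {F : fieldType} {N : nat}.

Lemma cubic_homog (i j k : 'I_N) : ('X_i * 'X_j * 'X_k : {mpoly F[N]}) \is 3.-homog.
Proof.
have hX l : ('X_l : {mpoly F[N]}) \is 1.-homog by rewrite dhomogX; apply/eqP/mdeg1.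
exact: dhomogM (dhomogM (hX i) (hX j)) (hX k).
Qed.

Lemma homogCM d (c : F) (p : {mpoly F[N]}) : p \is d.-homog -> c%:MP * p \is d.-homog.
Proof. by move=> hp; rewrite mul_mpolyC rpredZ. Qed.

End Cubics.

(** The neutral summand: it adds a variable and keeps the count. *)
Lemma good_zero (R : realType) : good (0 : {mpoly R[i][1]}) 1.
Proof.
refine (@good_of_system R 1 _ (fun=> 1) (fun=> -1) (fun T x => [:: x 0%N])
  [:: [:: (0, 1%N)]] 1 (rpred0 _) _ _ _ _ _ _ _ _ _ _ _) => //.
- by move=> _; rewrite oner_eq0.
- by move=> _; rewrite oppr_eq0 oner_eq0.
- move=> y yE; case=> -[|?] // lt; rewrite (bool_irrelevance lt isT).
  have := yE (Ordinal (isT : (0 < 1)%N)); rewrite /= => ->.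
  by rewrite mderiv0 mpolyCN mpolyC1; ring.
- move=> T I y idI tf Iy; have := Iy 0%N isT; rewrite /= => I0.
  by case=> // _; rewrite unlock /=; apply: (ideal_eq I0); ring.
Qed.

Lemma good_cube (R : realType) : exists f : {mpoly R[i][1]}, good f 2.
Proof.
pose x : {mpoly R[i][1]} := 'X_(Ordinal (isT : (0 < 1)%N)).
pose k : {mpoly R[i][1]} := (3%:R^-1)%:MP.
have kE : k * 3%:R = 1 by rewrite -mpolyC_nat -mpolyCM mulVf ?pnatr_eq0 // mpolyC1.
exists (k * (x * x * x)).
refine (@good_of_system R 1 _ (fun=> 1) (fun=> 1) (fun T x => [:: x 0%N ^+ 2 - x 0%N])
  [:: [:: (0, 1%N); (1, 1%N)]] 2 _ _ _ _ _ _ _ _ _ _ _ _) => //.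
- by rewrite homogCM ?cubic_homog.
- by move=> _; rewrite oner_eq0.
- by move=> _; rewrite oner_eq0.
- by move=> S T g y; rewrite /= rmorphB rmorphXn.
- move=> y yE; case=> -[|?] // lt; rewrite (bool_irrelevance lt isT).
  have := yE (Ordinal (isT : (0 < 1)%N)); rewrite /= -/x => ->.
  by rewrite !(mderivD, mderivB, mderivM, mderivC, mderivXU) -/x !eqE /=; ring: kE.
- move=> T I y idI tf Iy; have := Iy 0%N isT; rewrite /= => I0.
  by case=> // _; rewrite unlock /=; apply: (ideal_eq I0); ring.
Qed.

(** Comes from x^2 y + x^3/3: here y = x^2 and x (x + 1) (2x - 1) = 0. *)
Definition system3 (T : comNzRingType) (x : nat -> T) : seq T :=
  [:: 2%:R * x 0%N * x 1%N + x 0%N ^+ 2 - x 0%N; x 0%N ^+ 2 - x 1%N].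

Lemma good3 (R : realType) : exists f : {mpoly R[i][2]}, good f 3.
Proof.
pose x : {mpoly R[i][2]} := 'X_(Ordinal (isT : (0 < 2)%N)).
pose z : {mpoly R[i][2]} := 'X_(Ordinal (isT : (1 < 2)%N)).
pose k : {mpoly R[i][2]} := (3%:R^-1)%:MP.
have kE : k * 3%:R = 1 by rewrite -mpolyC_nat -mpolyCM mulVf ?pnatr_eq0 // mpolyC1.
exists (x * x * z + k * (x * x * x)).
refine (@good_of_system R 2 _ (fun=> 1) (fun=> 1) system3
  [:: [:: (0, 1%N); (- 1, 1%N); (1, 2%N)]; [:: (0, 1%N); (1, 1%N); (1, 4%N)]] 3
  _ _ _ _ _ _ _ _ _ _ _ _) => //.
- by apply: rpredD; rewrite ?homogCM ?cubic_homog.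
- by move=> _; rewrite oner_eq0.
- by move=> _; rewrite oner_eq0.
- by move=> S T g y; rewrite /system3 /= !(rmorph_nat, rmorphXn, rmorphB, rmorphD, rmorphM).
- move=> y yE i; have := yE (Ordinal (isT : (0 < 2)%N)); have := yE (Ordinal (isT : (1 < 2)%N)).
  rewrite /= -/x -/z /system3 => -> ->.
  by case: i => -[|[|?]] // lt; rewrite (bool_irrelevance lt isT)
    !(mderivD, mderivB, mderivM, mderivC, mderivXU) -/x -/z !eqE /=; ring: kE.
- move=> T I y idI tf Iy; have := Iy 0%N isT; have := Iy 1%N isT; rewrite /system3 /=.
  set a := y 0%N; set b := y 1%N => Ib Ia.
  have Ix : I (a * (a + 1) * (2%:R * a - 1)).
    by apply: (ideal_comb2 idI (a := 1) (b := 2%:R * a) Ia Ib); ring.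
  case=> [|[|?]] // _; rewrite unlock /=; first by apply: (ideal_eq Ix); rewrite -/a; ring.
  apply: (ideal_comb2 idI (a := a * (a - 1) * (2%:R * a + 1))
    (b := - (4%:R * (b ^+ 2 + b * a ^+ 2 + a ^+ 4) - 5%:R * (b + a ^+ 2) + 1)) Ix Ib).
  by rewrite -/b; ring.
Qed.

(** Comes from x y z: the zeros are the origin and the four sign vectors with product 1. *)
Definition system5 (T : comNzRingType) (x : nat -> T) : seq T :=
  [:: x 1%N * x 2%N - x 0%N; x 0%N * x 2%N - x 1%N; x 0%N * x 1%N - x 2%N].

Lemma system5_split (T : comNzRingType) (I : set T) (x y z : T) : is_ideal I ->
  I (y * z - x) -> I (x * z - y) -> I (x * y - z) -> I (x * (x - 1) * (x + 1)).
Proof.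
move=> idI I0 I1 I2.
by apply: (ideal_comb3 idI (a := - (x ^+ 2 - 1)) (b := z) (c := x * z) I0 I1 I2); ring.
Qed.

Lemma good5 (R : realType) : exists f : {mpoly R[i][3]}, good f 5.
Proof.
pose x : {mpoly R[i][3]} := 'X_(Ordinal (isT : (0 < 3)%N)).
pose y : {mpoly R[i][3]} := 'X_(Ordinal (isT : (1 < 3)%N)).
pose z : {mpoly R[i][3]} := 'X_(Ordinal (isT : (2 < 3)%N)).
pose rs : seq (int * nat) := [:: (0, 1%N); (1, 1%N); (- 1, 1%N)].
exists (x * y * z).
refine (@good_of_system R 3 _ (fun=> 1) (fun=> 1) system5 [:: rs; rs; rs] 5
  (cubic_homog _ _ _) _ _ _ _ _ _ _ _ _ _ _) => //.
- by move=> _; rewrite oner_eq0.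
- by move=> _; rewrite oner_eq0.
- by move=> S T g u; rewrite /system5 /= !(rmorphB, rmorphM).
- move=> u uE i; have := uE (Ordinal (isT : (0 < 3)%N)).
  have := uE (Ordinal (isT : (1 < 3)%N)); have := uE (Ordinal (isT : (2 < 3)%N)).
  rewrite /= -/x -/y -/z /system5 => -> -> ->.
  by case: i => -[|[|[|?]]] // lt; rewrite (bool_irrelevance lt isT)
    !(mderivM, mderivXU) -/x -/y -/z !eqE /=; ring.
- move=> T I u idI tf Iu.
  have := Iu 0%N isT; have := Iu 1%N isT; have := Iu 2%N isT; rewrite /system5 /=.
  set a := u 0%N; set b := u 1%N; set c := u 2%N => I2 I1 I0.
  case=> [|[|[|?]]] // _; rewrite unlock /=.
  + by apply: ideal_eq (system5_split idI I0 I1 I2) _; rewrite -/a; ring.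
  + apply: ideal_eq (system5_split (x := b) (y := a) (z := c) idI I1 I0 _) _; last first.
      by rewrite -/b; ring.
    by rewrite mulrC.
  + apply: ideal_eq (system5_split (x := c) (y := a) (z := b) idI I2 _ _) _; last first.
    * by rewrite -/c; ring.
    * by rewrite mulrC.
    * by rewrite mulrC.
Qed.

(** With h = 1 - w, each of x and y is 0 or h, so w is 0, 6h^2 (in two ways) or 12h^2, giving 1 + 2
    + 2 + 2 zeros. The roots of w = m h^2 are rational when 4m + 1 is a square; 6 and 12 give 25 and
    49. *)
Definition system7 (T : comNzRingType) (x : nat -> T) : seq T :=
  [:: x 0%N * x 2%N + x 0%N ^+ 2 - x 0%N; x 1%N * x 2%N + x 1%N ^+ 2 - x 1%N;
      6%:R * (x 0%N ^+ 2 + x 1%N ^+ 2) - x 2%N].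

Section System7.
Context {T : comNzRingType} (I : set T) (x y w : T).
Hypotheses (idI : is_ideal I) (I0 : I (x * w + x ^+ 2 - x)) (I1 : I (y * w + y ^+ 2 - y)).

(* With h = 1 - w, both x/h and y/h are idempotent, hence x + y is 0, h or 2h,
   and w = 6 h (x + y). *)
Lemma system7_split_w : I (6%:R * (x ^+ 2 + y ^+ 2) - w) ->
  I (w * (2%:R * w - 3%:R) * (3%:R * w - 2%:R) * (3%:R * w - 4%:R) * (4%:R * w - 3%:R)).
Proof.
move=> I2; pose r0 := x * w + x ^+ 2 - x; pose r1 := y * w + y ^+ 2 - y.
pose r2 := 6%:R * (x ^+ 2 + y ^+ 2) - w.
pose h := 1 - w; pose s := x + y.
have IT : I (s * (s - h) * (s - 2%:R * h)).
  apply: (ideal_comb2 idI (a := s - 2%:R * h + 2%:R * y) (b := s - 2%:R * h + 2%:R * x) I0 I1).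
  by rewrite /r0 /r1 /s /h; ring.
have Ir : I (6%:R * (r0 + r1) - r2).
  by apply: (ideal_comb3 idI (a := 6%:R) (b := 6%:R) (c := -1) I0 I1 I2); rewrite /r0 /r1 /r2; ring.
apply: (ideal_comb2 idI (a := 216%:R * h ^+ 3)
  (b := (w - 6%:R * h ^+ 2) * (w - 12%:R * h ^+ 2) + 6%:R * h * s * (w - 12%:R * h ^+ 2)
     + 36%:R * h ^+ 2 * s * (s - h)) IT Ir).
by rewrite /r0 /r1 /r2 /s /h; ring.
Qed.

(** Since x w = x (1 - x) modulo [I], the quintic for w yields x times the quintic at 1 - x. The
    cofactor of the first equation is the telescoped difference quotient of the quintic. *)
Lemma system7_split_x :
  I (w * (2%:R * w - 3%:R) * (3%:R * w - 2%:R) * (3%:R * w - 4%:R) * (4%:R * w - 3%:R)) ->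
  I (x * (x - 1) * (2%:R * x + 1) * (3%:R * x - 1) * (3%:R * x + 1) * (4%:R * x - 1)).
Proof.
move=> Iw; pose v := 1 - x.
apply: (ideal_comb2 idI (a := - x)
  (b := (2%:R * v - 3%:R) * (3%:R * v - 2%:R) * (3%:R * v - 4%:R) * (4%:R * v - 3%:R)
    + 2%:R * w * (3%:R * v - 2%:R) * (3%:R * v - 4%:R) * (4%:R * v - 3%:R)
    + 3%:R * w * (2%:R * w - 3%:R) * (3%:R * v - 4%:R) * (4%:R * v - 3%:R)
    + 3%:R * w * (2%:R * w - 3%:R) * (3%:R * w - 2%:R) * (4%:R * v - 3%:R)
    + 4%:R * w * (2%:R * w - 3%:R) * (3%:R * w - 2%:R) * (3%:R * w - 4%:R)) Iw I0).
by rewrite /v; ring.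
Qed.

End System7.

Lemma good7 (R : realType) : exists f : {mpoly R[i][3]}, good f 7.
Proof.
pose x : {mpoly R[i][3]} := 'X_(Ordinal (isT : (0 < 3)%N)).
pose y : {mpoly R[i][3]} := 'X_(Ordinal (isT : (1 < 3)%N)).
pose w : {mpoly R[i][3]} := 'X_(Ordinal (isT : (2 < 3)%N)).
pose k : {mpoly R[i][3]} := (3%:R^-1)%:MP.
have kE : k * 3%:R = 1 by rewrite -mpolyC_nat -mpolyCM mulVf ?pnatr_eq0 // mpolyC1.
pose s : R[i] := sqrtC 3%:R.
have s0 : s != 0 by rewrite sqrtC_eq0 pnatr_eq0.
have ss : s * s = 3%:R by rewrite -expr2 sqrtCK.
have sR : s \is Num.real by rewrite qualifE /= sqrtC_ge0 ler0n.
pose S : {mpoly R[i][3]} := s%:MP.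
have SS : S * S = 3%:R by rewrite -mpolyCM ss mpolyC_nat.
exists (S * (w * x * x) + S * (w * y * y) + k * (x * x * x) + k * (y * y * y)).
(* Scaling the third coordinate by twice the root of 3 makes all coefficients integers. *)
pose d (i : 'I_3) : R[i] := if val i == 2%N then 2%:R * s else 1.
pose c (i : 'I_3) : R[i] := if val i == 2%N then s / 6%:R else 1.
pose rx : seq (int * nat) := [:: (0, 1%N); (1, 1%N); (- 1, 2%N); (1, 3%N); (- 1, 3%N); (1, 4%N)].
pose rw : seq (int * nat) := [:: (0, 1%N); (3, 2%N); (2, 3%N); (4, 3%N); (3, 4%N)].
refine (@good_of_system R 3 _ d c system7 [:: rx; rx; rw] 7
  _ (erefl _) _ _ _ _ (fun _ _ => erefl _) _ _ isT isT _).
- by do 3?apply: rpredD; rewrite homogCM ?cubic_homog.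
- by move=> i; rewrite /d; case: ifP => _ //; apply: realM => //; apply: realn.
- by move=> i; rewrite /d; case: ifP; rewrite ?oner_eq0 // mulf_neq0 // pnatr_eq0.
- by move=> i; rewrite /c; case: ifP; rewrite ?oner_eq0 // mulf_neq0 // invr_eq0 pnatr_eq0.
- by move=> S' T g u; rewrite /system7 /= !(rmorph_nat, rmorphXn, rmorphB, rmorphD, rmorphM).
- move=> u uE i; have := uE (Ordinal (isT : (0 < 3)%N)).
  have := uE (Ordinal (isT : (1 < 3)%N)); have := uE (Ordinal (isT : (2 < 3)%N)).
  rewrite /= -/x -/y -/w /system7 => -> -> ->.
  pose e : {mpoly R[i][3]} := (6%:R^-1)%:MP; have eE : e * 6%:R = 1.
    by rewrite /e -mpolyC_nat -mpolyCM mulVf ?pnatr_eq0 // mpolyC1.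
  case: i => -[|[|[|?]]] // lt; rewrite (bool_irrelevance lt isT)
    !(mderivD, mderivM, mderivC, mderivXU) -/x -/y -/w !eqE /d /c /= ?mpolyCM -/S -/e ?mpolyC_nat.
  + by ring: kE SS.
  + by ring: kE SS.
  + have SeE : S * S * e * 2%:R = 1 by rewrite SS; ring: eE.
    transitivity (e * 6%:R * S * (x ^+ 2 + y ^+ 2) - S * S * e * 2%:R * w); last by ring.
    by rewrite SeE eE; ring.
- move=> T I u idI tf Iu.
  have := Iu 0%N isT; have := Iu 1%N isT; have := Iu 2%N isT; rewrite /system7 /=.
  set a := u 0%N; set b := u 1%N; set v := u 2%N => I2 I1 I0.
  have Iw := system7_split_w idI I0 I1 I2.
  case=> [|[|[|?]]] // _; rewrite unlock /=.
  + by apply: ideal_eq (system7_split_x idI I0 Iw) _; rewrite -/a; ring.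
  + by apply: ideal_eq (system7_split_x idI I1 Iw) _; rewrite -/b; ring.
  + by apply: ideal_eq Iw _; rewrite -/v; ring.
- by vm_compute.
Qed.

(** Comes from x y z + w^2 (x + y + z)/2. For w = 0 there are the five zeros of [system5]; otherwise
    x + y + z = 1, and (x, y, z) is (1/3, 1/3, 1/3) with w = 2/3 or -2/3, or a permutation of (-1,
    -1, 3) with w = 2 or -2. *)
Definition system13 (T : comNzRingType) (x : nat -> T) : seq T :=
  [:: 2%:R * x 1%N * x 2%N + x 3%N ^+ 2 - 2%:R * x 0%N;
      2%:R * x 0%N * x 2%N + x 3%N ^+ 2 - 2%:R * x 1%N;
      2%:R * x 0%N * x 1%N + x 3%N ^+ 2 - 2%:R * x 2%N;
      x 3%N * (x 0%N + x 1%N + x 2%N) - x 3%N].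

Section System13.
Context {T : comNzRingType} (I : set T) (x y z w : T).
Hypotheses (idI : is_ideal I) (tf : forall k a, I (k.+1%:R * a) -> I a).
Hypotheses (I0 : I (2%:R * y * z + w ^+ 2 - 2%:R * x))
  (I1 : I (2%:R * x * z + w ^+ 2 - 2%:R * y)) (I2 : I (2%:R * x * y + w ^+ 2 - 2%:R * z))
  (I3 : I (w * (x + y + z) - w)).

Let r0 := 2%:R * y * z + w ^+ 2 - 2%:R * x.
Let r1 := 2%:R * x * z + w ^+ 2 - 2%:R * y.
Let r2 := 2%:R * x * y + w ^+ 2 - 2%:R * z.
Let r3 := w * (x + y + z) - w.

Lemma system13_diff : I ((y - z) * (1 + x)).
Proof.
apply: (tf (k := 1)); apply: (ideal_comb2 idI (a := -1) (b := 1) I1 I2).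
by ring.
Qed.

Lemma system13_square : I (w * (w ^+ 2 - (1 - x) ^+ 2)).
Proof.
apply: (tf (k := 1)).
by apply: (ideal_comb3 idI (a := w) (b := w) (c := - 2%:R * (x - 1)) I1 I2 I3); ring.
Qed.

(** Where w is nonzero and x is not -1, one has y = z = (1 - x)/2 and w^2 = (1 - x)^2, so the first
    equation becomes 3 (1 - x)^2 = 4x. *)
Lemma system13_cubic : I (w * ((x + 1) * (3%:R * x - 1) * (x - 3%:R))).
Proof.
apply: (ideal_comb4 idI (a := w * (y - z)) (b := - (1 + x) * (y + z + 1 - x))
  (c := 2%:R * w * (1 + x)) (d := - 2%:R * (1 + x)) system13_diff I3 I0 system13_square).
by ring.
Qed.

Lemma system13_split_w :
  I (w * (w - 2%:R) * (w + 2%:R) * (3%:R * w - 2%:R) * (3%:R * w + 2%:R)).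
Proof.
apply: (ideal_comb2 idI (a := 3%:R * x - 5%:R)
  (b := 9%:R * (w ^+ 2 + (1 - x) ^+ 2) - 40%:R) system13_cubic system13_square).
by ring.
Qed.

(** The cubic [t] kills w, so after multiplication by [t] the first equations become those of x y
    z. *)
Lemma system13_split_x : I (x * (x - 1) * (x + 1) * (3%:R * x - 1) * (x - 3%:R)).
Proof.
pose t := (x + 1) * (3%:R * x - 1) * (x - 3%:R).
have IA a b : I (2%:R * a + w ^+ 2 - 2%:R * b) -> I (t * (a - b)).
  move=> Iab; apply: (tf (k := 1)).
  by apply: (ideal_comb2 idI (a := t) (b := - w) Iab system13_cubic); rewrite /t; ring.
have IA0 : I (t * (y * z - x)) by apply: IA; rewrite mulrA.
have IA1 : I (t * (x * z - y)) by apply: IA; rewrite mulrA.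
apply: (ideal_comb3 idI (a := z) (b := x * z * ((3%:R * x - 1) * (x - 3%:R)))
  (c := 1 - x) IA1 system13_diff IA0).
by rewrite /t; ring.
Qed.

End System13.

Lemma good13 (R : realType) : exists f : {mpoly R[i][4]}, good f 13.
Proof.
pose x : {mpoly R[i][4]} := 'X_(Ordinal (isT : (0 < 4)%N)).
pose y : {mpoly R[i][4]} := 'X_(Ordinal (isT : (1 < 4)%N)).
pose z : {mpoly R[i][4]} := 'X_(Ordinal (isT : (2 < 4)%N)).
pose w : {mpoly R[i][4]} := 'X_(Ordinal (isT : (3 < 4)%N)).
pose k : {mpoly R[i][4]} := (2%:R^-1)%:MP.
have kE : k * 2%:R = 1 by rewrite -mpolyC_nat -mpolyCM mulVf ?pnatr_eq0 // mpolyC1.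
exists (x * y * z + k * (w * w * x) + k * (w * w * y) + k * (w * w * z)).
pose c (i : 'I_4) : R[i] := if val i == 3%N then 1 else 2%:R^-1.
pose rx : seq (int * nat) := [:: (0, 1%N); (1, 1%N); (- 1, 1%N); (1, 3%N); (3, 1%N)].
pose rw : seq (int * nat) := [:: (0, 1%N); (2, 1%N); (- 2, 1%N); (2, 3%N); (- 2, 3%N)].
refine (@good_of_system R 4 _ (fun=> 1) c system13 [:: rx; rx; rx; rw] 13
  _ (erefl _) (fun=> real1 _) (fun=> oner_neq0 _) _ _ (fun _ _ => erefl _) _ _ isT isT _).
- by do 3?apply: rpredD; rewrite ?homogCM ?cubic_homog.
- by move=> i; rewrite /c; case: ifP; rewrite ?oner_eq0 // invr_eq0 pnatr_eq0.
- by move=> S T g u; rewrite /system13 /= !(rmorph_nat, rmorphXn, rmorphB, rmorphD, rmorphM).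
- move=> u uE i; have := uE (Ordinal (isT : (0 < 4)%N)).
  have := uE (Ordinal (isT : (1 < 4)%N)); have := uE (Ordinal (isT : (2 < 4)%N)).
  have := uE (Ordinal (isT : (3 < 4)%N)).
  rewrite /= -/x -/y -/z -/w /system13 => -> -> -> ->.
  case: i => -[|[|[|[|?]]]] // lt; rewrite (bool_irrelevance lt isT)
    !(mderivD, mderivM, mderivC, mderivXU) -/x -/y -/z -/w !eqE /c /= -/k.
  + by transitivity (k * 2%:R * y * z + k * w ^+ 2 - k * 2%:R * x); [rewrite kE|]; ring.
  + by transitivity (k * 2%:R * x * z + k * w ^+ 2 - k * 2%:R * y); [rewrite kE|]; ring.
  + by transitivity (k * 2%:R * x * y + k * w ^+ 2 - k * 2%:R * z); [rewrite kE|]; ring.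
  + by ring: kE.
- move=> T I u idI tf Iu.
  have := Iu 0%N isT; have := Iu 1%N isT; have := Iu 2%N isT; have := Iu 3%N isT.
  rewrite /system13 /=; set v := u 3%N; set a := u 0%N; set b := u 1%N; set e := u 2%N.
  move=> I3 I2 I1 I0.
  have ba : 2%:R * b * a = 2%:R * a * b by ring.
  have eb : 2%:R * e * b = 2%:R * b * e by ring.
  have ea : 2%:R * e * a = 2%:R * a * e by ring.
  case=> [|[|[|[|?]]]] // _; rewrite unlock /=.
  + by apply: ideal_eq (system13_split_x idI tf I0 I1 I2 I3) _; rewrite -/a; ring.
  + have := @system13_split_x _ I b a e v idI tf; rewrite ba [b + a]addrC.
    by move/(_ I1 I0 I2 I3) => Ib; apply: ideal_eq Ib _; rewrite -/b; ring.
  + have := @system13_split_x _ I e a b v idI tf; rewrite eb ea (_ : e + a + b = a + b + e); last by ring.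
    by move/(_ I2 I0 I1 I3) => Ie; apply: ideal_eq Ie _; rewrite -/e; ring.
  + by apply: ideal_eq (system13_split_w idI tf I0 I1 I2 I3) _; rewrite -/v; ring.
- by vm_compute.
Qed.

(** With h = 1 - w the first equations read hx = 2yz and its permutations. The zeros are the origin,
    six with h = 0 (one of x, y, z being 1 or -1), and four sign choices of absolute value 1 for w =
    3 and of absolute value 1/3 for w = 1/3. *)
Definition system15 (T : comNzRingType) (x : nat -> T) : seq T :=
  [:: x 0%N * x 3%N + 2%:R * x 1%N * x 2%N - x 0%N;
      x 1%N * x 3%N + 2%:R * x 0%N * x 2%N - x 1%N;
      x 2%N * x 3%N + 2%:R * x 0%N * x 1%N - x 2%N;
      x 0%N ^+ 2 + x 1%N ^+ 2 + x 2%N ^+ 2 - x 3%N].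

Section System15.
Context {T : comNzRingType} (I : set T) (x y z w : T).
Hypotheses (idI : is_ideal I) (tf : forall k a, I (k.+1%:R * a) -> I a).
Hypotheses (I0 : I (x * w + 2%:R * y * z - x)) (I1 : I (y * w + 2%:R * x * z - y))
  (I2 : I (z * w + 2%:R * x * y - z)) (I3 : I (x ^+ 2 + y ^+ 2 + z ^+ 2 - w)).

Let h := 1 - w.

(** h^2 (hx) = 2 (hy) (hz) = 8 x^2 y z = 4 x^2 (hx). *)
Lemma system15_hx : I (h * x * (h ^+ 2 - 4%:R * x ^+ 2)).
Proof.
apply: (ideal_comb3 idI (a := 4%:R * x ^+ 2 - h ^+ 2) (b := - 4%:R * x * y)
  (c := - 2%:R * h * y) I0 I1 I2).
by rewrite /h; ring.
Qed.

(** h x^2, h y^2 and h z^2 all equal 2xyz. *)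
Lemma system15_hw : I (h * w - 3%:R * h * x ^+ 2).
Proof.
apply: (ideal_comb4 idI (a := 2%:R * x) (b := - y) (c := - z) (d := - h) I0 I1 I2 I3).
by rewrite /h; ring.
Qed.

Lemma system15_split_w : I (w * (w - 1) * (w - 3%:R) * (3%:R * w - 1)).
Proof.
apply: (ideal_comb2 idI (a := - 9%:R * x)
  (b := - (3%:R * h ^+ 2 - 4%:R * w - 12%:R * x ^+ 2)) system15_hx system15_hw).
by rewrite /h; ring.
Qed.

(** h^2 x = 2hyz = 2x (y^2 + z^2) = 2x (w - x^2). *)
Lemma system15_quadratic : I (x * (2%:R * x ^+ 2 - 2%:R * w + h ^+ 2)).
Proof.
apply: (ideal_comb4 idI (a := - h) (b := - z) (c := - y) (d := 2%:R * x) I0 I1 I2 I3).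
by rewrite /h; ring.
Qed.

Lemma system15_split_x : I (x * (x - 1) * (x + 1) * (3%:R * x - 1) * (3%:R * x + 1)).
Proof.
apply: (tf (k := 3)); pose m := 2%:R * w - h ^+ 2.
apply: (ideal_comb2 idI (a := - (3%:R * w - 11%:R))
  (b := 9%:R * (2%:R * x ^+ 2 + m) - 20%:R - (3%:R * w - 11%:R) * 2%:R * h)
  system15_hx system15_quadratic).
by rewrite /m /h; ring.
Qed.

End System15.

Lemma good15 (R : realType) : exists f : {mpoly R[i][4]}, good f 15.
Proof.
pose x : {mpoly R[i][4]} := 'X_(Ordinal (isT : (0 < 4)%N)).
pose y : {mpoly R[i][4]} := 'X_(Ordinal (isT : (1 < 4)%N)).
pose z : {mpoly R[i][4]} := 'X_(Ordinal (isT : (2 < 4)%N)).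
pose w : {mpoly R[i][4]} := 'X_(Ordinal (isT : (3 < 4)%N)).
pose s : R[i] := sqrtC 2%:R.
have s0 : s != 0 by rewrite sqrtC_eq0 pnatr_eq0.
have sR : s \is Num.real by rewrite qualifE /= sqrtC_ge0 ler0n.
pose S : {mpoly R[i][4]} := s%:MP.
have SS : S * S = 2%:R by rewrite -mpolyCM -expr2 sqrtCK mpolyC_nat.
pose k : {mpoly R[i][4]} := (2%:R^-1)%:MP.
have kE : k * 2%:R = 1 by rewrite -mpolyC_nat -mpolyCM mulVf ?pnatr_eq0 // mpolyC1.
pose Sk : {mpoly R[i][4]} := (s / 2%:R)%:MP.
have SkE : Sk = S * k by rewrite -mpolyCM.
exists (Sk * (w * x * x) + Sk * (w * y * y) + Sk * (w * z * z) + 2%:R%:MP * (x * y * z)).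
pose d (i : 'I_4) : R[i] := if val i == 3%N then s else 1.
pose c (i : 'I_4) : R[i] := if val i == 3%N then s / 2%:R else 1.
pose rx : seq (int * nat) := [:: (0, 1%N); (1, 1%N); (- 1, 1%N); (1, 3%N); (- 1, 3%N)].
pose rw : seq (int * nat) := [:: (0, 1%N); (1, 1%N); (3, 1%N); (1, 3%N)].
refine (@good_of_system R 4 _ d c system15 [:: rx; rx; rx; rw] 15
  _ (erefl _) _ _ _ _ (fun _ _ => erefl _) _ _ isT isT _).
- by do 3?apply: rpredD; rewrite ?homogCM ?cubic_homog.
- by move=> i; rewrite /d; case: ifP => _ //; apply: real1.
- by move=> i; rewrite /d; case: ifP; rewrite ?oner_eq0.
- by move=> i; rewrite /c; case: ifP; rewrite ?oner_eq0 // mulf_neq0 // invr_eq0 pnatr_eq0.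
- by move=> S' T g u; rewrite /system15 /= !(rmorph_nat, rmorphXn, rmorphB, rmorphD, rmorphM).
- move=> u uE i; have := uE (Ordinal (isT : (0 < 4)%N)).
  have := uE (Ordinal (isT : (1 < 4)%N)); have := uE (Ordinal (isT : (2 < 4)%N)).
  have := uE (Ordinal (isT : (3 < 4)%N)).
  rewrite /= -/x -/y -/z -/w /system15 => -> -> -> ->.
  case: i => -[|[|[|[|?]]]] // lt; rewrite (bool_irrelevance lt isT)
    !(mderivD, mderivM, mderivC, mderivXU) -/x -/y -/z -/w !eqE /d /c /= -/Sk SkE -/S mpolyC_nat.
  + by ring: kE.
  + by ring: kE.
  + by ring: kE.
  + transitivity (S * k * (x ^+ 2 + y ^+ 2 + z ^+ 2) - S * S * k * w); last by ring.
    by rewrite SS [2%:R * k]mulrC kE; ring.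
- move=> T I u idI tf Iu.
  have := Iu 0%N isT; have := Iu 1%N isT; have := Iu 2%N isT; have := Iu 3%N isT.
  rewrite /system15 /=; set v := u 3%N; set a := u 0%N; set b := u 1%N; set e := u 2%N.
  move=> I3 I2 I1 I0.
  have ba : 2%:R * b * a = 2%:R * a * b by ring.
  have eb : 2%:R * e * b = 2%:R * b * e by ring.
  have ea : 2%:R * e * a = 2%:R * a * e by ring.
  case=> [|[|[|[|?]]]] // _; rewrite unlock /=.
  + by apply: ideal_eq (system15_split_x idI tf I0 I1 I2 I3) _; rewrite -/a; ring.
  + have := @system15_split_x _ I b a e v idI tf; rewrite ba [b ^+ 2 + _]addrC.
    by move/(_ I1 I0 I2 I3) => Ib; apply: ideal_eq Ib _; rewrite -/b; ring.
  + have := @system15_split_x _ I e a b v idI tf; rewrite eb ea.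
    rewrite (_ : e ^+ 2 + a ^+ 2 + b ^+ 2 = a ^+ 2 + b ^+ 2 + e ^+ 2); last by ring.
    by move/(_ I2 I0 I1 I3) => Ie; apply: ideal_eq Ie _; rewrite -/e; ring.
  + by apply: ideal_eq (system15_split_w idI I0 I1 I2 I3) _; rewrite -/v; ring.
- by vm_compute.
Qed.

(** A nonzero y forces w = 3 and a nonzero t forces w = 1/3, while x is 0 or 3 (1 - w)/7. There are
    three zeros with y = t = 0, four with w = 3 and four with w = 1/3; the coefficients make them
    all rational. *)
Definition system11 (T : comNzRingType) (x : nat -> T) : seq T :=
  [:: 3%:R * x 0%N * x 3%N + 7%:R * x 0%N ^+ 2 - 3%:R * x 0%N;
      x 1%N * x 3%N - 3%:R * x 1%N; 3%:R * x 2%N * x 3%N - x 2%N;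
      2%:R * x 0%N ^+ 2 + 3%:R * x 1%N ^+ 2 + 3%:R * x 2%N ^+ 2 - x 3%N].

Section System11.
Context {T : comNzRingType} (I : set T) (x y t w : T).
Hypotheses (idI : is_ideal I) (tf : forall k a, I (k.+1%:R * a) -> I a).
Hypotheses (I0 : I (3%:R * x * w + 7%:R * x ^+ 2 - 3%:R * x)) (I1 : I (y * w - 3%:R * y))
  (I2 : I (3%:R * t * w - t)) (I3 : I (2%:R * x ^+ 2 + 3%:R * y ^+ 2 + 3%:R * t ^+ 2 - w)).

(** The factor [m] kills y and t and leaves w = 2x^2. With x = 3h/7 this reads 49w = 18h^2, that is
    (2w - 9) (9w - 2) = 0. *)
Lemma system11_split_w :
  I (w * (w - 3%:R) * (3%:R * w - 1) * (2%:R * w - 9%:R) * (9%:R * w - 2%:R)).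
Proof.
pose m := (w - 3%:R) * (3%:R * w - 1); pose h := 1 - w.
have Im : I (m * (w - 2%:R * x ^+ 2)).
  apply: (ideal_comb3 idI (a := 3%:R * (3%:R * w - 1) * y) (b := 3%:R * (w - 3%:R) * t)
    (c := - m) I1 I2 I3).
  by rewrite /m; ring.
apply: (ideal_comb2 idI (a := - (49%:R * (w + 2%:R * x ^+ 2) - 18%:R * h ^+ 2))
  (b := - m * 4%:R * x * (7%:R * x + 3%:R * h)) Im I0).
by rewrite /m /h; ring.
Qed.

(** As for [system7_split_x], now with 3xw = x (3 - 7x); the factor 49 comes from the last two
    linear factors. *)
Lemma system11_split_x :
  I (x * (7%:R * x - 3%:R) * (7%:R * x + 6%:R) * (7%:R * x - 2%:R) * (2%:R * x + 3%:R)
    * (3%:R * x - 1)).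
Proof.
apply: (tf (k := 48)); pose u := 3%:R * w; pose v := 3%:R - 7%:R * x.
apply: (ideal_comb2 idI (a := - 27%:R * x)
  (b := (v - 9%:R) * (v - 1) * (2%:R * v - 27%:R) * (3%:R * v - 2%:R)
    + u * (v - 1) * (2%:R * v - 27%:R) * (3%:R * v - 2%:R)
    + u * (u - 9%:R) * (2%:R * v - 27%:R) * (3%:R * v - 2%:R)
    + 2%:R * u * (u - 9%:R) * (u - 1) * (3%:R * v - 2%:R)
    + 3%:R * u * (u - 9%:R) * (u - 1) * (2%:R * u - 27%:R)) system11_split_w I0).
by rewrite /u /v; ring.
Qed.

Lemma system11_yt : I (y * t).
Proof.
apply: (tf (k := 7)).
by apply: (ideal_comb2 idI (a := - 3%:R * t) (b := y) I1 I2); ring.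
Qed.

(** Multiplication by y imposes w = 3 and t = 0, so 2x^2 = 3 - 3y^2 and x (7x + 6) = 0; hence 2x^2
    is 0 or 72/49. *)
Lemma system11_split_y :
  I (y * (y - 1) * (y + 1) * (7%:R * y - 5%:R) * (7%:R * y + 5%:R)).
Proof.
pose nu := 2%:R * x ^+ 2; pose mu := 3%:R - 3%:R * y ^+ 2.
have Is : I (y * (nu - mu)).
  apply: (ideal_comb3 idI (a := y) (b := - 3%:R * t) (c := 1) I3 system11_yt I1).
  by rewrite /nu /mu; ring.
have Ixy : I (x * y * (7%:R * x + 6%:R)).
  by apply: (ideal_comb2 idI (a := y) (b := - 3%:R * x) I0 I1); ring.
apply: (tf (k := 8)).
apply: (ideal_comb2 idI (a := 4%:R * x * (7%:R * x - 6%:R))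
  (b := - (49%:R * (nu + mu) - 72%:R)) Ixy Is).
by rewrite /nu /mu; ring.
Qed.

(** Multiplication by t imposes w = 1/3 and y = 0, so 6x^2 = 1 - 9t^2 is 0 or 24/49. *)
Lemma system11_split_t :
  I (t * (3%:R * t - 1) * (3%:R * t + 1) * (21%:R * t - 5%:R) * (21%:R * t + 5%:R)).
Proof.
pose nu := 6%:R * x ^+ 2; pose mu := 1 - 9%:R * t ^+ 2.
have Is : I (t * (nu - mu)).
  apply: (ideal_comb3 idI (a := 3%:R * t) (b := - 9%:R * y) (c := 1) I3 system11_yt I2).
  by rewrite /nu /mu; ring.
have Ixt : I (x * t * (7%:R * x - 2%:R)).
  by apply: (ideal_comb2 idI (a := t) (b := - x) I0 I2); ring.
apply: (ideal_comb2 idI (a := 36%:R * x * (7%:R * x + 2%:R))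
  (b := - (49%:R * (nu + mu) - 24%:R)) Ixt Is).
by rewrite /nu /mu; ring.
Qed.

End System11.

Lemma good11 (R : realType) : exists f : {mpoly R[i][4]}, good f 11.
Proof.
pose x : {mpoly R[i][4]} := 'X_(Ordinal (isT : (0 < 4)%N)).
pose y : {mpoly R[i][4]} := 'X_(Ordinal (isT : (1 < 4)%N)).
pose t : {mpoly R[i][4]} := 'X_(Ordinal (isT : (2 < 4)%N)).
pose z : {mpoly R[i][4]} := 'X_(Ordinal (isT : (3 < 4)%N)).
pose s : R[i] := sqrtC 2%:R.
have s0 : s != 0 by rewrite sqrtC_eq0 pnatr_eq0.
have sR : s \is Num.real by rewrite qualifE /= sqrtC_ge0 ler0n.
pose S : {mpoly R[i][4]} := s%:MP.
have SS : S * S = 2%:R by rewrite -mpolyCM -expr2 sqrtCK mpolyC_nat.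
pose k : {mpoly R[i][4]} := (2%:R^-1)%:MP.
have kE : k * 2%:R = 1 by rewrite -mpolyC_nat -mpolyCM mulVf ?pnatr_eq0 // mpolyC1.
have SkE : S * S * k = 1 by rewrite SS mulrC.
pose a : {mpoly R[i][4]} := (3%:R^-1)%:MP.
have aE : a * 3%:R = 1 by rewrite -mpolyC_nat -mpolyCM mulVf ?pnatr_eq0 // mpolyC1.
exists (z * x * x + a * (z * y * y) + 3%:R%:MP * (z * t * t)
  + (7%:R / 3%:R / 3%:R)%:MP * (x * x * x)).
pose d (i : 'I_4) : R[i] := nth 0 [:: 1; s / 3%:R; s; 2%:R] i.
pose c (i : 'I_4) : R[i] := nth 0 [:: 3%:R^-1; s / 2%:R; s / 2%:R; 2%:R^-1] i.
pose rx : seq (int * nat) := [:: (0, 1%N); (3, 7%N); (- 6, 7%N); (2, 7%N); (- 3, 2%N); (1, 3%N)].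
pose ry : seq (int * nat) := [:: (0, 1%N); (1, 1%N); (- 1, 1%N); (5, 7%N); (- 5, 7%N)].
pose rt : seq (int * nat) := [:: (0, 1%N); (1, 3%N); (- 1, 3%N); (5, 21%N); (- 5, 21%N)].
pose rw : seq (int * nat) := [:: (0, 1%N); (3, 1%N); (1, 3%N); (9, 2%N); (2, 9%N)].
refine (@good_of_system R 4 _ d c system11 [:: rx; ry; rt; rw] 11
  _ (erefl _) _ _ _ _ (fun _ _ => erefl _) _ _ isT isT _).
- by do 3?apply: rpredD; rewrite ?homogCM ?cubic_homog.
- by case=> -[|[|[|[|?]]]] // lt; rewrite /d /= ?realM ?realV ?realn ?real1.
- by case=> -[|[|[|[|?]]]] // lt; rewrite /d /= ?mulf_neq0 ?invr_eq0 ?pnatr_eq0 ?oner_eq0.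
- by case=> -[|[|[|[|?]]]] // lt; rewrite /c /= ?mulf_neq0 ?invr_eq0 ?pnatr_eq0 ?oner_eq0.
- by move=> S' T g u; rewrite /system11 /= !(rmorph_nat, rmorphXn, rmorphB, rmorphD, rmorphM).
- move=> u uE i; have := uE (Ordinal (isT : (0 < 4)%N)).
  have := uE (Ordinal (isT : (1 < 4)%N)); have := uE (Ordinal (isT : (2 < 4)%N)).
  have := uE (Ordinal (isT : (3 < 4)%N)).
  rewrite /= -/x -/y -/t -/z /system11 => -> -> -> ->.
  case: i => -[|[|[|[|?]]]] // lt; rewrite (bool_irrelevance lt isT)
    !(mderivD, mderivM, mderivC, mderivXU) -/x -/y -/t -/z !eqE /d /c /=
    !(mpolyCM, mpolyC1, mpolyC_nat) -/a -/k -/S.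
  + transitivity (2%:R * z * x + 7%:R * a * (a * 3%:R) * x ^+ 2 - x); first by ring.
    transitivity (a * 3%:R * (2%:R * z * x) + 7%:R * a * x ^+ 2 - a * 3%:R * x); last by ring.
    by rewrite aE; ring.
  + transitivity (S * S * k * (a * 2%:R * z * y) - S * S * k * (a * 3%:R * y)); last by ring.
    by rewrite SkE aE; ring.
  + transitivity (S * S * k * (6%:R * z * t) - S * S * k * t); last by ring.
    by rewrite SkE; ring.
  + transitivity (k * 2%:R * x ^+ 2 + S * S * k * (a * 3%:R * a * y ^+ 2)
      + 3%:R * (S * S * k * t ^+ 2) - k * 2%:R * z); last by ring.
    by rewrite SkE kE aE; ring.
- move=> T I u idI tf Iu.
  have := Iu 0%N isT; have := Iu 1%N isT; have := Iu 2%N isT; have := Iu 3%N isT.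
  rewrite /system11 /=; set v := u 3%N; set b := u 0%N; set e := u 1%N; set g := u 2%N.
  move=> I3 I2 I1 I0.
  case=> [|[|[|[|?]]]] // _; rewrite unlock /=.
  + by apply: ideal_eq (system11_split_x idI tf I0 I1 I2 I3) _; rewrite -/b; ring.
  + by apply: ideal_eq (system11_split_y idI tf I0 I1 I2 I3) _; rewrite -/e; ring.
  + by apply: ideal_eq (system11_split_t idI tf I0 I1 I2 I3) _; rewrite -/g; ring.
  + by apply: ideal_eq (system11_split_w idI I0 I1 I2 I3) _; rewrite -/v; ring.
- by vm_compute.
Qed.

(** * Conclusion *)

Lemma good_neq0 (R : realType) (N : nat) (f : {mpoly R[i][N]}) u :
  good f u -> (1 < u)%N -> f != 0.
Proof.
move=> [_ _ [L [uL sL LP]]] u1; apply: contraTneq u1 => f0; rewrite -leqNgt -sL.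
apply: (uniq_leq_size uL (s2 := [:: 0])) => v /LP fv; rewrite inE; apply/eqP/rowP => i.
by rewrite -fv f0 mderiv0 meval0 mxE.
Qed.

(* The gradient of (x + i y)^3 is proportional to the isotropic vector (1, i). *)
Lemma good_isotropic (R : realType) :
  exists f : {mpoly R[i][2]}, (exists v, f.@[v] != 0) /\ good f 1.
Proof.
pose x : {mpoly R[i][2]} := 'X_(Ordinal (isT : (0 < 2)%N)).
pose y : {mpoly R[i][2]} := 'X_(Ordinal (isT : (1 < 2)%N)).
pose J : {mpoly R[i][2]} := ('i : R[i])%:MP.
have JJ : J * J = -1 by rewrite -mpolyCM -expr2 sqrCi mpolyCN mpolyC1.
pose k : {mpoly R[i][2]} := (3%:R^-1)%:MP.
have kE : k * 3%:R = 1 by rewrite -mpolyC_nat -mpolyCM mulVf ?pnatr_eq0 // mpolyC1.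
pose l := x + J * y; pose f := k * (l * l * l); exists f; split.
  exists (fun i => (val i == 0%N)%:R).
  rewrite /f /l /k /J !(mevalM, mevalD, mevalC, mevalXU) /= mulr0 addr0 !mulr1.
  by rewrite invr_eq0 pnatr_eq0.
have d0 : f^`M(Ordinal (isT : (0 < 2)%N)) = l * l.
  rewrite !(mderivD, mderivM, mderivC, mderivXU) -/x -/y !eqE /=.
  transitivity (k * 3%:R * (l * l)); last by rewrite kE mul1r.
  by rewrite /l; ring.
have d1 : f^`M(Ordinal (isT : (1 < 2)%N)) = J * (l * l).
  rewrite !(mderivD, mderivM, mderivC, mderivXU) -/x -/y !eqE /=.
  transitivity (k * 3%:R * (J * (l * l))); last by rewrite kE mul1r.
  by rewrite /l; ring.
have idI := fix_ideal_ideal f.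
have I0 := fix_ideal_gen f (Ordinal (isT : (0 < 2)%N)); rewrite d0 -/x in I0.
have I1 := fix_ideal_gen f (Ordinal (isT : (1 < 2)%N)); rewrite d1 -/y in I1.
(* As 1 + J^2 = 0, the quadratic parts cancel and only x + J y remains. *)
have Il : fix_ideal f l.
  apply: (ideal_comb2 idI (a := -1) (b := - J) I0 I1).
  transitivity (x + J * y - (1 + J * J) * (l * l)); last by ring.
  by rewrite JJ /l; ring.
have IX (i : 'I_2) : fix_ideal f 'X_i.
  case: i => -[|[|?]] // lt; rewrite (bool_irrelevance lt isT).
    by apply: (ideal_comb2 idI (a := l) (b := -1) Il I0); rewrite -/x; ring.
  by apply: (ideal_comb2 idI (a := J * l) (b := -1) Il I1); rewrite -/y; ring.
split.
- rewrite /f homogCM //; have hl : l \is 1.-homog.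
    by apply: rpredD; rewrite ?homogCM ?dhomogX //; apply/eqP/mdeg1.
  exact: dhomogM (dhomogM hl hl) hl.
- move=> i; exists [:: 0]; split=> // [c|]; first by rewrite inE => /eqP ->; apply: real0.
  by rewrite big_seq1 mpolyC0 subr0; apply: IX.
- exists [:: 0]; split=> // v; rewrite inE; split=> [/eqP -> i|fv].
    suff l0 : l.@[fun j => (0 : 'rV[R[i]]_2) 0 j] = 0.
      case: i => -[|[|?]] // lt; rewrite (bool_irrelevance lt isT) ?d0 ?d1.
        by rewrite mevalM l0 mul0r mxE.
      by rewrite mevalM [(l * l).@[_]]mevalM l0 !mulr0 mxE.
    by rewrite mevalD mevalM !mevalXU !mxE mulr0 addr0.
  apply/eqP/rowP => i; rewrite mxE.
  by have := (fixed_pointP f v).1 fv _ (IX i); rewrite mevalXU.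
Qed.

Lemma oplus0_neq0 (R : realType) (N M : nat) (f : {mpoly R[i][N]}) v :
  f.@[v] != 0 -> mpoly_oplus f (0 : {mpoly R[i][M]}) != 0.
Proof.
apply: contraNneq => f0; pose w (i : 'I_(N + M)) := if fintype.split i is inl j then v j else 0.
have := congr1 (meval w) f0; rewrite meval0 mevalD rmorph0 meval0 addr0 meval_rename => <-.
by apply/eqP/meval_eq => j; rewrite /w /= (unsplitK (inl j)).
Qed.

Lemma exists_oplus (R : realType) (N M u w : nat) :
  (exists f : {mpoly R[i][N]}, good f u) -> (exists g : {mpoly R[i][M]}, good g w) ->
  exists h : {mpoly R[i][N + M]}, good h (u * w).
Proof. by move=> [f hf] [g hg]; exists (mpoly_oplus f g); apply: good_oplus. Qed.

(** In three variables only 5 and 7 are not products of smaller counts. In four, counts up to 8 take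
    a zero summand, larger even counts a factor 2, and 9 is 3 times 3; this leaves 11, 13 and 15. *)
Lemma exists_good (R : realType) :
  (forall u, (0 < u <= 8)%N -> exists f : {mpoly R[i][3]}, good f u) /\
  (forall u, (0 < u <= 16)%N -> exists f : {mpoly R[i][4]}, good f u).
Proof.
have g1 : exists f : {mpoly R[i][1]}, good f 1 by exists 0; apply: good_zero.
have g2 := good_cube R; have g3 := good3 R; have g5 := good5 R; have g7 := good7 R.
have g11 := good11 R; have g13 := good13 R; have g15 := good15 R.
have g3' u : (0 < u <= 8)%N -> exists f : {mpoly R[i][3]}, good f u.
  case: u => [|[|[|[|[|[|[|[|[|u]]]]]]]]] // _.
  - exact: (exists_oplus (exists_oplus g1 g1) g1).
  - exact: (exists_oplus (exists_oplus g1 g1) g2).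
  - exact: (exists_oplus g3 g1).
  - exact: (exists_oplus (exists_oplus g1 g2) g2).
  - exact: (exists_oplus g3 g2).
  - exact: (exists_oplus (exists_oplus g2 g2) g2).
split=> // u /andP[u0 u16]; have [u8|u9] := leqP u 8.
  by rewrite -[u]muln1; apply: (exists_oplus (g3' u _) g1); rewrite u0.
have [odd_u|even_u] := boolP (odd u); last first.
  rewrite -[u]odd_double_half (negPf even_u) add0n -muln2.
  by apply: (exists_oplus (g3' u./2 _) g2); lia.
have : u \in [:: 9; 11; 13; 15]%N by rewrite !inE; lia.
rewrite !inE => /or4P[] /eqP -> //.
exact: (exists_oplus g3 g3).
Qed.

Theorem theorem4p1 (R : realType) :
  (forall (n : nat) (f : {mpoly R[i][n.+1]}),
     f \is 3.-homog -> proj_dim_le (reg_ideal f) 0 ->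
     ([set p | regular_eigenpoint f p] #<= `I_(2 ^ n.+1 - 1))%card) /\
  (forall t : nat, (t <= 7)%N ->
     exists f : {mpoly R[i][3]},
       [/\ f \is 3.-homog, f != 0, proj_reduced (reg_ideal f) &
           consists_of_real_points (reg_ideal f) t]) /\
  (forall t : nat, (t <= 15)%N ->
     exists f : {mpoly R[i][4]},
       [/\ f \is 3.-homog, f != 0, proj_reduced (reg_ideal f) &
           consists_of_real_points (reg_ideal f) t]).
Proof.
split; first by move=> n f; apply: card_regular_eigenpoints.
have finish n t (f : {mpoly R[i][n.+1]}) : f != 0 -> good f t.+1 ->
    [/\ f \is 3.-homog, f != 0, proj_reduced (reg_ideal f) &
        consists_of_real_points (reg_ideal f) t].
  move=> f0 gf; split; [by case: gf | exact: f0 | exact: good_reduced gf | exact: good_points gf].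
(* For t = 0 a nonzero cubic fixing only the origin is required, whence the isotropic one; for t > 0
   the count exceeds 1, which already forces f to be nonzero. *)
have [f [[v fv] gf]] := good_isotropic R.
have [e3 e4] := exists_good R; split=> -[_|t le].
- exists (mpoly_oplus f (0 : {mpoly R[i][1]})); apply: (finish 2).
    exact: oplus0_neq0 fv.
  exact: (good_oplus gf (good_zero R)).
- have [|g gg] := e3 t.+2; first by rewrite /=; lia.
  by exists g; apply: (finish 2 _ _ (good_neq0 gg _) gg).
- have g0 := good_oplus (good_zero R) (good_zero R).
  exists (mpoly_oplus f (0 : {mpoly R[i][2]})); apply: (finish 3).
    exact: oplus0_neq0 fv.
  have -> : (0 : {mpoly R[i][2]}) = mpoly_oplus (0 : {mpoly R[i][1]}) (0 : {mpoly R[i][1]}).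
    by rewrite /mpoly_oplus !rmorph0 addr0.
  exact: (good_oplus gf g0).
- have [|g gg] := e4 t.+2; first by rewrite /=; lia.
  by exists g; apply: (finish 3 _ _ (good_neq0 gg _) gg).
Qed.
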